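(* Let $(X,\mathcal{O}_X)$ be a topological ringed space, let $\mathcal{L}$ be a Lie algebroid over $(X,\mathcal{O}_X)$ that is locally free as an $\mathcal{O}_X$-module, and let $(\mathcal{L}',\phi)$ be an $\mathcal{L}$-Lie algebroid with $\mathcal{L}'$ locally free as an $\mathcal{O}_X$-module. Then the PBW isomorphisms of graded $\mathcal{O}_X$-algebras $$\psi_{\mathcal{L}'}:\operatorname{gr}(\mathcal{U}(\mathcal{O}_X,\mathcal{L}'))\to\mathcal{S}ym_{\mathcal{O}_X}(\mathcal{L}'),\qquad \psi_{\mathcal{L}}:\operatorname{gr}(\mathcal{U}(\mathcal{O}_X,\mathcal{L}))\to\mathcal{S}ym_{\mathcal{O}_X}(\mathcal{L})$$ satisfy the compatibility condition $\tilde\phi\circ\psi_{\mathcal{L}'}=\psi_{\mathcal{L}}\circ\operatorname{gr}(\bar\phi)$, where $\bar\phi=\mathcal{U}(\phi):\mathcal{U}(\mathcal{O}_X,\mathcal{L}')\to\mathcal{U}(\mathcal{O}_X,\mathcal{L})$ and $\tilde\phi:\mathcal{S}ym_{\mathcal{O}_X}(\mathcal{L}')\to\mathcal{S}ym_{\mathcal{O}_X}(\mathcal{L})$ are the maps induced by $\phi$.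
   Context: $\mathbb{K}$ is $\mathbb{R}$, $\mathbb{C}$, or an algebraically closed field of characteristic $0$; $\mathbb{K}_X$ is the constant sheaf. A topological ringed space $(X,\mathcal{O}_X)$ is a topological space with a $\mathbb{K}_X$-subalgebra $\mathcal{O}_X$ of the sheaf of continuous $\mathbb{K}$-valued functions ($\mathbb{K}$ with Euclidean or Zariski topology). $\mathcal{T}_X=\mathcal{D}er_{\mathbb{K}_X}(\mathcal{O}_X)$ with commutator bracket. A Lie algebroid $(\mathcal{L},[\cdot,\cdot],\mathfrak{a})$ is an $\mathcal{O}_X$-module that is also a sheaf of $\mathbb{K}$-Lie algebras, with an $\mathcal{O}_X$-linear Lie algebra homomorphism $\mathfrak{a}:\mathcal{L}\to\mathcal{T}_X$ satisfying $[D,fD']=f[D,D']+\mathfrak{a}(D)(f)D'$. Morphisms are $\mathcal{O}_X$-linear Lie algebra homomorphisms commuting with anchors. An $\mathcal{L}$-Lie algebroid $(\mathcal{L}',\phi)$ is a Lie algebroid $\mathcal{L}'$ with a Lie algebroid morphism $\phi:\mathcal{L}'\to\mathcal{L}$. The universal enveloping algebroid $\mathcal{U}(\mathcal{O}_X,\mathcal{L})$ is the sheafification of $U\mapsto\mathcal{U}(\mathcal{O}_X(U),\mathcal{L}(U))$, the universal enveloping algebras of the Lie–Rinehart algebras $(\mathcal{O}_X(U),\mathcal{L}(U))$. It is a unital associative $\mathbb{K}_X$-algebra with an algebra map $\mathcal{O}_X\hookrightarrow\mathcal{U}(\mathcal{O}_X,\mathcal{L})$ and an $\mathcal{O}_X$-linear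 map $\iota_{\mathcal{L}}:\mathcal{L}\to\mathcal{U}(\mathcal{O}_X,\mathcal{L})$, $D\mapsto\bar D$, generated by $\mathcal{O}_X$ and $\iota_{\mathcal{L}}(\mathcal{L})$ and universal for the relations $\bar D\bar D'-\bar D'\bar D=\overline{[D,D']}$, $\bar Df-f\bar D=\mathfrak{a}(D)(f)$. It is functorial in $\mathcal{L}$. It is filtered by $\mathcal{U}_{(k)}(\mathcal{O}_X,\mathcal{L})$, spanned by $\mathcal{O}_X$ and the powers $\iota_{\mathcal{L}}(\mathcal{L})^m$, $1\le m\le k$; $\operatorname{gr}(\mathcal{U}(\mathcal{O}_X,\mathcal{L}))=\bigoplus_{k\ge0}\mathcal{U}_{(k)}/\mathcal{U}_{(k-1)}$ ($\mathcal{U}_{(-1)}=0$) is a commutative graded $\mathcal{O}_X$-algebra, and $\operatorname{gr}(\bar\phi)$ is the map induced by $\bar\phi$ on graded quotients. $\mathcal{S}ym_{\mathcal{O}_X}(\mathcal{L})$ is the symmetric algebra. For $\mathcal{L}$ locally free, the (known) PBW theorem states that the symmetrization map $\tilde\psi_{\mathcal{L}}:\mathcal{S}ym_{\mathcal{O}_X}(\mathcal{L})\to\operatorname{gr}(\mathcal{U}(\mathcal{O}_X,\mathcal{L}))$, $D_1\otimes\cdots\otimes D_k\mapsto\frac1{k!}\sum_{\sigma\in S_k}\bar D_{\sigma(1)}\cdots\bar D_{\sigma(k)}$ (class in degree $k$), is an isomorphism of graded $\mathcal{O}_X$-algebras; put $\psi_{\mathcal{L}}=(\tilde\psi_{\mathcal{L}})^{-1}$,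 and similarly $\psi_{\mathcal{L}'}=(\tilde\psi_{\mathcal{L}'})^{-1}$. *)

(* Defs.v *)
From HB Require Import structures.
From mathcomp Require Import all_boot all_order all_algebra perm complex.
From mathcomp Require Import all_classical all_reals topology normedtype.

Set Implicit Arguments.
Unset Strict Implicit.
Unset Printing Implicit Defensive.

Import GRing.Theory numFieldNormedType.Exports.
Local Open Scope classical_set_scope.
Local Open Scope quotient_scope.
Local Open Scope ring_scope.

Definition rmorph_of (A B : pzRingType) (f : A -> B)
    (fB : {morph f : x y / x - y}) (fM : monoid_morphism f) :
    {rmorphism A -> B} :=
  HB.pack f (GRing.isZmodMorphism.Build A B f fB)
            (GRing.isMonoidMorphism.Build A B f fM).

(* Ring operations satisfying the ring laws up to a congruence; the quotient
   by the congruence is a ring. *)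
Record setoid_ring := SetoidRing {
  scar :> Type;
  seqv : scar -> scar -> Prop;
  szero : scar;
  sone : scar;
  sopp : scar -> scar;
  sadd : scar -> scar -> scar;
  smul : scar -> scar -> scar;
  seqv_refl : forall a, seqv a a;
  seqv_sym : forall a b, seqv a b -> seqv b a;
  seqv_trans : forall a b c, seqv a b -> seqv b c -> seqv a c;
  sopp_cong : forall a a', seqv a a' -> seqv (sopp a) (sopp a');
  sadd_cong : forall a a' b b',
    seqv a a' -> seqv b b' -> seqv (sadd a b) (sadd a' b');
  smul_cong : forall a a' b b',
    seqv a a' -> seqv b b' -> seqv (smul a b) (smul a' b');
  saddA : forall a b c, seqv (sadd a (sadd b c)) (sadd (sadd a b) c);
  saddC : forall a b, seqv (sadd a b) (sadd b a);
  sadd0 : forall a, seqv (sadd szero a) a;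
  saddN : forall a, seqv (sadd (sopp a) a) szero;
  smulA : forall a b c, seqv (smul a (smul b c)) (smul (smul a b) c);
  smul1l : forall a, seqv (smul sone a) a;
  smul1r : forall a, seqv (smul a sone) a;
  smulDl : forall a b c,
    seqv (smul (sadd a b) c) (sadd (smul a c) (smul b c));
  smulDr : forall a b c,
    seqv (smul c (sadd a b)) (sadd (smul c a) (smul c b))
}.

Section Quotient.
Variable S : setoid_ring.

Definition seqvb : rel {classic S} := fun a b => `[< seqv (a : S) b >].

Lemma seqvb_equiv : equiv_class_of seqvb.
Proof.
split.
- by move=> a; apply/asboolP; exact: seqv_refl.
- by move=> a b; apply/asboolP/asboolP; exact: seqv_sym.
- move=> b a c /asboolP ab /asboolP bc; apply/asboolP; exact: seqv_trans ab bc.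
Qed.

Canonical seqvb_rel := EquivRelPack seqvb_equiv.

Definition sring_quot := {eq_quot seqvb}.
HB.instance Definition _ := Choice.on sring_quot.

Definition cls (a : S) : sring_quot := \pi_({eq_quot seqvb}) (a : {classic S}).
Definition rep (q : sring_quot) : S := repr (q : {eq_quot seqvb}).

Lemma clsP a b : cls a = cls b <-> seqv a b.
Proof.
split; first by move/eqquotP/asboolP.
by move=> h; apply/eqquotP/asboolP.
Qed.

Lemma repK q : cls (rep q) = q.
Proof. exact: reprK. Qed.

Lemma rep_cls a : seqv (rep (cls a)) a.
Proof. by apply/clsP; rewrite repK. Qed.

Lemma cls_surj q : exists a, q = cls a.
Proof. by exists (rep q); rewrite repK. Qed.

Let zero := cls (szero S).
Let one := cls (sone S).
Let opp q := cls (sopp (rep q)).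
Let add p q := cls (sadd (rep p) (rep q)).
Let mul p q := cls (smul (rep p) (rep q)).

Let oppE a : opp (cls a) = cls (sopp a).
Proof. by apply/clsP/sopp_cong; exact: rep_cls. Qed.
Let addE a b : add (cls a) (cls b) = cls (sadd a b).
Proof. by apply/clsP/sadd_cong; exact: rep_cls. Qed.
Let mulE a b : mul (cls a) (cls b) = cls (smul a b).
Proof. by apply/clsP/smul_cong; exact: rep_cls. Qed.

Let addA : associative add.
Proof.
move=> p q r; case: (cls_surj p) (cls_surj q) (cls_surj r).
move=> a -> [b ->] [c ->].
by rewrite !addE; apply/clsP; exact: saddA.
Qed.
Let addC : commutative add.
Proof.
move=> p q; case: (cls_surj p) (cls_surj q) => a -> [b ->].
by rewrite !addE; apply/clsP; exact: saddC.
Qed.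
Let add0 : left_id zero add.
Proof.
by move=> p; have [a ->] := cls_surj p; rewrite addE; apply/clsP; exact: sadd0.
Qed.
Let addN : left_inverse zero opp add.
Proof.
move=> p; have [a ->] := cls_surj p.
by rewrite oppE addE; apply/clsP; exact: saddN.
Qed.
Let mulA : associative mul.
Proof.
move=> p q r; case: (cls_surj p) (cls_surj q) (cls_surj r).
move=> a -> [b ->] [c ->].
by rewrite !mulE; apply/clsP; exact: smulA.
Qed.
Let mul1l : left_id one mul.
Proof.
by move=> p; have [a ->] := cls_surj p; rewrite mulE; apply/clsP; exact: smul1l.
Qed.
Let mul1r : right_id one mul.
Proof.
by move=> p; have [a ->] := cls_surj p; rewrite mulE; apply/clsP; exact: smul1r.
Qed.
Let mulDl : left_distributive mul add.
Proof.
move=> p q r; case: (cls_surj p) (cls_surj q) (cls_surj r).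
move=> a -> [b ->] [c ->].
by rewrite addE !mulE addE; apply/clsP; exact: smulDl.
Qed.
Let mulDr : right_distributive mul add.
Proof.
move=> r p q; case: (cls_surj p) (cls_surj q) (cls_surj r).
move=> a -> [b ->] [c ->].
by rewrite addE !mulE addE; apply/clsP; exact: smulDr.
Qed.

HB.instance Definition _ := GRing.isPzRing.Build sring_quot
  addA addC add0 addN mulA mul1l mul1r mulDl mulDr.

Lemma cls0 : cls (szero S) = 0. Proof. by []. Qed.
Lemma cls1 : cls (sone S) = 1. Proof. by []. Qed.
Lemma clsN a : cls (sopp a) = - cls a. Proof. by rewrite -oppE. Qed.
Lemma clsD a b : cls (sadd a b) = cls a + cls b. Proof. by rewrite -addE. Qed.
Lemma clsM a b : cls (smul a b) = cls a * cls b. Proof. by rewrite -mulE. Qed.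

End Quotient.

(* A map out of the quotient induced by an operation-preserving map of
   representatives. *)
Section QuotientMap.
Variables (S : setoid_ring) (B : pzRingType) (f : S -> B).
Hypothesis f_eqv : forall a b, seqv a b -> f a = f b.
Hypothesis f1 : f (sone S) = 1.
Hypothesis fN : forall a, f (sopp a) = - f a.
Hypothesis fD : forall a b, f (sadd a b) = f a + f b.
Hypothesis fM : forall a b, f (smul a b) = f a * f b.

Let g (q : sring_quot S) : B := f (rep q).
Let gE a : g (cls a) = f a. Proof. exact/f_eqv/rep_cls. Qed.
Let gB : {morph g : x y / x - y}.
Proof.
move=> p q; case: (cls_surj p) (cls_surj q) => a -> [b ->].
by rewrite -clsN -clsD !gE fD fN.
Qed.
Let gM : monoid_morphism g.
Proof.
split; first by rewrite -cls1 gE f1.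
move=> p q; case: (cls_surj p) (cls_surj q) => a -> [b ->].
by rewrite -clsM !gE fM.
Qed.

Definition quot_map : {rmorphism sring_quot S -> B} := rmorph_of gB gM.

Lemma quot_mapE a : quot_map (cls a) = f a. Proof. exact: gE. Qed.

End QuotientMap.


(* The associative algebra generated by R and L, in which R is a subring of
   scalars acting on L from the left, subject to D D' - D' D = br D D' and
   D f - f D = act D f.  For a Lie-Rinehart algebra with bracket br and anchor
   act this is the universal enveloping algebra; no separate relations for the
   base field K are needed, as K acts through K -> R.  For br = 0 and act = 0
   the relations say that all generators commute, and this is the symmetric
   algebra of the R-module L. *)
Section Enveloping.
Variables (R : comPzRingType) (L : lmodType R).
Variables (br : L -> L -> L) (act : L -> R -> R).

Inductive env_term : Type :=
| TScal of R
| TVec of L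
| TOpp of env_term
| TAdd of env_term & env_term
| TMul of env_term & env_term.

Inductive env_rel : env_term -> env_term -> Prop :=
| env_refl a : env_rel a a
| env_sym a b : env_rel a b -> env_rel b a
| env_trans a b c : env_rel a b -> env_rel b c -> env_rel a c
| env_opp_cong a a' : env_rel a a' -> env_rel (TOpp a) (TOpp a')
| env_add_cong a a' b b' :
    env_rel a a' -> env_rel b b' -> env_rel (TAdd a b) (TAdd a' b')
| env_mul_cong a a' b b' :
    env_rel a a' -> env_rel b b' -> env_rel (TMul a b) (TMul a' b')
| env_addA a b c : env_rel (TAdd a (TAdd b c)) (TAdd (TAdd a b) c)
| env_addC a b : env_rel (TAdd a b) (TAdd b a)
| env_add0 a : env_rel (TAdd (TScal 0) a) a
| env_addN a : env_rel (TAdd (TOpp a) a) (TScal 0)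
| env_mulA a b c : env_rel (TMul a (TMul b c)) (TMul (TMul a b) c)
| env_mul1l a : env_rel (TMul (TScal 1) a) a
| env_mul1r a : env_rel (TMul a (TScal 1)) a
| env_mulDl a b c :
    env_rel (TMul (TAdd a b) c) (TAdd (TMul a c) (TMul b c))
| env_mulDr a b c :
    env_rel (TMul c (TAdd a b)) (TAdd (TMul c a) (TMul c b))
| env_scalD f g : env_rel (TScal (f + g)) (TAdd (TScal f) (TScal g))
| env_scalM f g : env_rel (TScal (f * g)) (TMul (TScal f) (TScal g))
| env_vecD D D' : env_rel (TVec (D + D')) (TAdd (TVec D) (TVec D'))
| env_vecZ f D : env_rel (TVec (f *: D)) (TMul (TScal f) (TVec D))
| env_vec_comm D D' :
    env_rel (TAdd (TMul (TVec D) (TVec D')) (TOpp (TMul (TVec D') (TVec D))))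
            (TVec (br D D'))
| env_scal_comm D f :
    env_rel (TAdd (TMul (TVec D) (TScal f)) (TOpp (TMul (TScal f) (TVec D))))
            (TScal (act D f)).

Definition env_setoid : setoid_ring :=
  SetoidRing env_refl env_sym env_trans env_opp_cong env_add_cong env_mul_cong
    env_addA env_addC env_add0 env_addN env_mulA env_mul1l env_mul1r
    env_mulDl env_mulDr.

Definition env : pzRingType := sring_quot env_setoid.

Let scal0 (f : R) : env := @cls env_setoid (TScal f).

Let scal0B : {morph scal0 : f g / f - g}.
Proof.
move=> f g; apply: (@addIr _ (scal0 g)).
rewrite subrK -(@clsD env_setoid); apply/clsP.
by apply: env_sym; rewrite -[X in TScal X](subrK g); exact: env_scalD.
Qed.

Let scal0M : monoid_morphism scal0.
Proof.
split=> // f g; rewrite -(@clsM env_setoid).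
by apply/clsP; exact: env_scalM.
Qed.

Definition env_scal : {rmorphism R -> env} := rmorph_of scal0B scal0M.
Definition env_vec (D : L) : env := @cls env_setoid (TVec D).

Lemma env_vecDE D D' : env_vec (D + D') = env_vec D + env_vec D'.
Proof. by rewrite -(@clsD env_setoid); apply/clsP; exact: env_vecD. Qed.

Lemma env_vecZE f D : env_vec (f *: D) = env_scal f * env_vec D.
Proof. by rewrite -(@clsM env_setoid); apply/clsP; exact: env_vecZ. Qed.

Lemma env_vec_commE D D' :
  env_vec D * env_vec D' - env_vec D' * env_vec D = env_vec (br D D').
Proof.
rewrite -!(@clsM env_setoid) -(@clsN env_setoid) -(@clsD env_setoid).
by apply/clsP; exact: env_vec_comm.
Qed.

Lemma env_scal_commE D f :
  env_vec D * env_scal f - env_scal f * env_vec D = env_scal (act D f).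
Proof.
rewrite -!(@clsM env_setoid) -(@clsN env_setoid) -(@clsD env_setoid).
by apply/clsP; exact: env_scal_comm.
Qed.

Lemma env_ind (P : env -> Prop) :
  (forall f, P (env_scal f)) -> (forall D, P (env_vec D)) ->
  (forall a, P a -> P (- a)) ->
  (forall a b, P a -> P b -> P (a + b)) ->
  (forall a b, P a -> P b -> P (a * b)) ->
  forall a, P a.
Proof.
move=> Ps Pv PN PD PM a; case: (cls_surj a) => {a} t ->.
elim: t => [f|D|a ha|a ha b hb|a ha b hb].
- exact: Ps.
- exact: Pv.
- by rewrite (@clsN env_setoid); exact: PN.
- by rewrite (@clsD env_setoid); exact: PD.
- by rewrite (@clsM env_setoid); exact: PM.
Qed.

(* The universal property. *)
Record env_compat (B : pzRingType) (h : {rmorphism R -> B}) (g : L -> B) :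
    Prop := EnvCompat {
  compatD : forall D D', g (D + D') = g D + g D';
  compatZ : forall f D, g (f *: D) = h f * g D;
  compat_br : forall D D', g D * g D' - g D' * g D = g (br D D');
  compat_act : forall D f, g D * h f - h f * g D = h (act D f)
}.

Section Lift.
Variables (B : pzRingType) (h : {rmorphism R -> B}) (g : L -> B).
Hypothesis gP : env_compat h g.

Let eval := fix eval (t : env_term) : B :=
  match t with
  | TScal f => h f
  | TVec D => g D
  | TOpp a => - eval a
  | TAdd a b => eval a + eval b
  | TMul a b => eval a * eval b
  end.

Let eval_eqv (a b : env_setoid) : seqv a b -> eval a = eval b.
Proof.
case: gP => gD gZ gbr gact; elim => //=.
- by move=> ? ? ? _ -> _ ->.
- by move=> ? ? _ ->.
- by move=> ? ? ? ? _ -> _ ->.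
- by move=> ? ? ? ? _ -> _ ->.
- by move=> *; rewrite addrA.
- by move=> *; rewrite addrC.
- by move=> *; rewrite rmorph0 add0r.
- by move=> *; rewrite rmorph0 addNr.
- by move=> *; rewrite mulrA.
- by move=> *; rewrite rmorph1 mul1r.
- by move=> *; rewrite rmorph1 mulr1.
- by move=> *; rewrite mulrDl.
- by move=> *; rewrite mulrDr.
- by move=> *; rewrite rmorphD.
- by move=> *; rewrite rmorphM.
Qed.

Definition env_lift : {rmorphism env -> B} :=
  @quot_map env_setoid B eval eval_eqv (rmorph1 h)
    (fun=> erefl) (fun _ _ => erefl) (fun _ _ => erefl).

Lemma env_lift_scal f : env_lift (env_scal f) = h f.
Proof. exact: (quot_mapE eval_eqv). Qed.

Lemma env_lift_vec D : env_lift (env_vec D) = g D.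
Proof. exact: (quot_mapE eval_eqv). Qed.

End Lift.
End Enveloping.

Lemma env_mor_ext (R : comPzRingType) (L : lmodType R) br act (B : pzRingType)
    (u v : {rmorphism @env R L br act -> B}) :
  (forall f, u (env_scal br act f) = v (env_scal br act f)) ->
  (forall D, u (env_vec br act D) = v (env_vec br act D)) -> u =1 v.
Proof.
move=> hs hv; apply: env_ind => //.
- by move=> a ha; rewrite !rmorphN ha.
- by move=> a b ha hb; rewrite !rmorphD ha hb.
- by move=> a b ha hb; rewrite !rmorphM ha hb.
Qed.


Record filtration (A : pzRingType) := Filtration {
  fl :> nat -> set A;
  fl1 : fl 0 1;
  flB : forall k a b, fl k a -> fl k b -> fl k (a - b);
  flS : forall k a, fl k a -> fl k.+1 a;
  flM : forall i j a b, fl i a -> fl j b -> fl (i + j)%N (a * b)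
}.

(* The associated graded ring: the direct sum over k of the quotients
   F k / F (k - 1), with F (-1) = 0.  An element is the class of a finitely
   supported sequence a with a k in F k. *)
Section AssociatedGraded.
Variables (A : pzRingType) (F : filtration A).

Definition below (k : nat) : set A := if k is j.+1 then F j else [set 0].

Lemma fl0 k : F k 0.
Proof.
elim: k => [|k ih]; last exact: flS.
by rewrite -(subrr 1); exact: (flB (fl1 F) (fl1 F)).
Qed.

Lemma flN k a : F k a -> F k (- a).
Proof. by move=> h; rewrite -sub0r; exact: flB (fl0 k) h. Qed.

Lemma flD k a b : F k a -> F k b -> F k (a + b).
Proof. by move=> ha hb; rewrite -[b]opprK; exact: flB ha (flN hb). Qed.

Lemma fl_sum k n (f : nat -> A) :
  (forall i, (i < n)%N -> F k (f i)) -> F k (\sum_(i < n) f i).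
Proof.
elim: n => [|n ih] h; first by rewrite big_ord0; exact: fl0.
by rewrite big_ord_recr; apply: flD; [apply: ih => i /ltnW; exact: h|exact: h].
Qed.

Lemma below0 k : below k 0. Proof. by case: k => //= k; exact: fl0. Qed.

Lemma belowN k a : below k a -> below k (- a).
Proof. by case: k => [|k] /=; [move=> ->; rewrite oppr0|exact: flN]. Qed.

Lemma belowD k a b : below k a -> below k b -> below k (a + b).
Proof. by case: k => [|k] /=; [move=> -> ->; rewrite addr0|exact: flD]. Qed.

Lemma below_sum k n (f : nat -> A) :
  (forall i, (i < n)%N -> below k (f i)) -> below k (\sum_(i < n) f i).
Proof.
elim: n => [|n ih] h; first by rewrite big_ord0; exact: below0.
by rewrite big_ord_recr; apply: belowD; [apply: ih => i /ltnW; exact: h|exact: h].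
Qed.

Lemma belowMr i j a b : F i a -> below j b -> below (i + j) (a * b).
Proof.
case: j => [|j] ha /=; first by move=> ->; rewrite mulr0; exact: below0.
by move=> hb; rewrite addnS; exact: flM.
Qed.

Lemma belowMl i j a b : below i a -> F j b -> below (i + j) (a * b).
Proof.
case: i => [|i] /= ha hb; last exact: flM.
by rewrite ha mul0r; exact: below0.
Qed.

Record gr_seq := GrSeq {
  gval :> nat -> A;
  gval_fl : forall k, F k (gval k);
  gval_fin : exists N, forall k, (N <= k)%N -> gval k = 0
}.

Definition gr_rel (a b : gr_seq) : Prop := forall k, below k (a k - b k).

Let gzero : gr_seq.
Proof. exists (fun=> 0); [exact: fl0|by exists 0%N]. Defined.

Let gone : gr_seq.
Proof.
exists (fun k => if k is 0%N then 1 else 0).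
- by case=> [|k]; [exact: fl1|exact: fl0].
- by exists 1%N; case.
Defined.

Let gopp (a : gr_seq) : gr_seq.
Proof.
exists (fun k => - a k); first by move=> k; exact/flN/gval_fl.
by case: (gval_fin a) => N h; exists N => k /h ->; rewrite oppr0.
Defined.

Let gadd (a b : gr_seq) : gr_seq.
Proof.
exists (fun k => a k + b k); first by move=> k; apply: flD; exact: gval_fl.
case: (gval_fin a) (gval_fin b) => N h [M h'].
by exists (maxn N M) => k; rewrite geq_max => /andP[/h -> /h' ->]; rewrite addr0.
Defined.

Let gmul (a b : gr_seq) : gr_seq.
Proof.
exists (fun k => \sum_(i < k.+1) a i * b (k - i)%N).
- move=> k; apply: (@fl_sum _ _ (fun i => a i * b (k - i)%N)) => i ik.
  by rewrite -(subnKC (_ : (i <= k)%N)) //; apply: flM; rewrite ?subnKC //;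
    exact: gval_fl.
- case: (gval_fin a) (gval_fin b) => N h [M h']; exists (N + M)%N => k kNM.
  apply: big1 => i _; have [Ni|iN] := leqP N i; first by rewrite h ?mul0r.
  rewrite h' ?mulr0 // leq_subRL; last by rewrite -ltnS ltn_ord.
  by apply: leq_trans kNM; rewrite leq_add2r ltnW.
Defined.

Let grefl a : gr_rel a a.
Proof. by move=> k; rewrite subrr; exact: below0. Qed.
Let greq (a b : gr_seq) : (forall k, a k = b k) -> gr_rel a b.
Proof. by move=> ab k; rewrite ab subrr; exact: below0. Qed.
Let gsym a b : gr_rel a b -> gr_rel b a.
Proof. by move=> h k; rewrite -opprB; exact/belowN/h. Qed.
Let gtrans a b c : gr_rel a b -> gr_rel b c -> gr_rel a c.
Proof.
move=> h h' k; rewrite -(subrK (b k) (a k)) -addrA; apply: belowD; first exact: h.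
exact: h'.
Qed.
Let gopp_cong a a' : gr_rel a a' -> gr_rel (gopp a) (gopp a').
Proof. by move=> h k; rewrite /= -opprD; exact/belowN/h. Qed.
Let gadd_cong a a' b b' :
  gr_rel a a' -> gr_rel b b' -> gr_rel (gadd a b) (gadd a' b').
Proof. by move=> h h' k; rewrite /= opprD addrACA; exact: belowD. Qed.
Let gmul_cong a a' b b' :
  gr_rel a a' -> gr_rel b b' -> gr_rel (gmul a b) (gmul a' b').
Proof.
move=> h h' k; rewrite /= -sumrB.
apply: (@below_sum _ _ (fun i => a i * b (k - i)%N - a' i * b' (k - i)%N)).
move=> i; rewrite ltnS => ik.
have -> : a i * b (k - i)%N - a' i * b' (k - i)%N =
    a i * (b (k - i)%N - b' (k - i)%N) + (a i - a' i) * b' (k - i)%N.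
  by rewrite mulrBr mulrBl addrA subrK.
rewrite -[k in below k](subnKC ik); apply: belowD.
- by apply: belowMr; [exact: gval_fl|exact: h'].
- by apply: belowMl; [exact: h|exact: gval_fl].
Qed.

Let gmul_rev (a b : gr_seq) k :
  gmul a b k = \sum_(i < k.+1) a (k - i)%N * b i.
Proof.
rewrite /= (reindex_inj rev_ord_inj) /=; apply: eq_bigr => i _.
by rewrite subSS subKn // -ltnS ltn_ord.
Qed.

Let gmulA a b c : gr_rel (gmul a (gmul b c)) (gmul (gmul a b) c).
Proof.
apply: greq => i; rewrite [RHS]gmul_rev [LHS]/=.
pose coef3 j k := a j * (b (i - j - k)%N * c k).
transitivity (\sum_(j < i.+1) \sum_(k < i.+1 | (k <= i - j)%N) coef3 j k).
  apply: eq_bigr => /= j _; rewrite -[\sum_(_ < _) _]/(gmul b c _) gmul_rev.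
  by rewrite big_distrr /= (big_ord_narrow_leq (leq_subr _ _)).
rewrite (exchange_big_dep predT) //=; apply: eq_bigr => k _.
transitivity (\sum_(j < i.+1 | (j <= i - k)%N) coef3 j k).
  apply: eq_bigl => j; rewrite -ltnS -(ltnS j) -!subSn ?leq_ord //.
  by rewrite -subn_gt0 -(subn_gt0 j) -!subnDA addnC.
rewrite (big_ord_narrow_leq (leq_subr _ _)) big_distrl /=.
by apply: eq_bigr => j _; rewrite /coef3 -!subnDA addnC mulrA.
Qed.

Let gmul1l a : gr_rel (gmul gone a) a.
Proof.
apply: greq => k; rewrite /= big_ord_recl /= subn0 mul1r.
by rewrite big1 ?addr0 // => i _; rewrite mul0r.
Qed.

Let gmul1r a : gr_rel (gmul a gone) a.
Proof.
apply: greq => k; rewrite gmul_rev big_ord_recl /= subn0 mulr1.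
by rewrite big1 ?addr0 // => i _; rewrite mulr0.
Qed.

Let gaddA a b c : gr_rel (gadd a (gadd b c)) (gadd (gadd a b) c).
Proof. by apply: greq => k /=; rewrite addrA. Qed.
Let gaddC a b : gr_rel (gadd a b) (gadd b a).
Proof. by apply: greq => k /=; rewrite addrC. Qed.
Let gadd0 a : gr_rel (gadd gzero a) a.
Proof. by apply: greq => k /=; rewrite add0r. Qed.
Let gaddN a : gr_rel (gadd (gopp a) a) gzero.
Proof. by apply: greq => k /=; rewrite addNr. Qed.
Let gmulDl a b c : gr_rel (gmul (gadd a b) c) (gadd (gmul a c) (gmul b c)).
Proof.
by apply: greq => k /=; rewrite -big_split; apply: eq_bigr => i _; rewrite mulrDl.
Qed.
Let gmulDr a b c : gr_rel (gmul c (gadd a b)) (gadd (gmul c a) (gmul c b)).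
Proof.
by apply: greq => k /=; rewrite -big_split; apply: eq_bigr => i _; rewrite mulrDr.
Qed.

Definition gr_setoid : setoid_ring :=
  SetoidRing grefl gsym gtrans gopp_cong gadd_cong gmul_cong gaddA gaddC gadd0
    gaddN gmulA gmul1l gmul1r gmulDl gmulDr.

Definition gr : pzRingType := sring_quot gr_setoid.

Lemma gr_relP (a b : gr_seq) :
  @cls gr_setoid a = @cls gr_setoid b <-> gr_rel a b.
Proof. exact: clsP. Qed.

Lemma gr_seqP (a b : gr_seq) :
  (forall k, a k = b k) -> @cls gr_setoid a = @cls gr_setoid b.
Proof. by move=> ab; apply/gr_relP; exact: greq. Qed.

Definition gr_mono (k : nat) (a : A) (ka : F k a) : gr_seq.
Proof.
exists (fun j => if j == k then a else 0).
- by move=> j; case: eqP => [->|_] //; exact: fl0.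
- by exists k.+1 => j kj; case: eqP => // jk; rewrite jk ltnn in kj.
Defined.

(* The class of a in degree k. *)
Definition gr_cls (k : nat) (a : A) (ka : F k a) : gr :=
  @cls gr_setoid (gr_mono ka).

Lemma gr_cls_eq k a b (ka : F k a) (kb : F k b) :
  below k (a - b) -> gr_cls ka = gr_cls kb.
Proof.
move=> h; apply/clsP => j /=; case: eqP => [->|_] //.
by rewrite subrr; exact: below0.
Qed.

Lemma gr_cls_irr k a b (ka : F k a) (kb : F k b) :
  a = b -> gr_cls ka = gr_cls kb.
Proof. by move=> ab; apply: gr_cls_eq; rewrite ab subrr; exact: below0. Qed.

Lemma gr_clsD k a b (ka : F k a) (kb : F k b) (kab : F k (a + b)) :
  gr_cls ka + gr_cls kb = gr_cls kab.
Proof.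
rewrite -(@clsD gr_setoid); apply/clsP/greq => j /=.
by case: eqP => // _; rewrite addr0.
Qed.

Lemma gr_clsN k a (ka : F k a) (kna : F k (- a)) :
  - gr_cls ka = gr_cls kna.
Proof.
rewrite -(@clsN gr_setoid); apply/clsP/greq => j /=.
by case: eqP => // _; rewrite oppr0.
Qed.

Lemma gr_cls0 k (k0 : F k 0) : gr_cls k0 = 0.
Proof. by rewrite -(@cls0 gr_setoid); apply/clsP/greq => j /=; case: eqP. Qed.

Lemma gr_cls1 (h : F 0%N 1) : gr_cls h = 1.
Proof. by rewrite -(@cls1 gr_setoid); apply/clsP/greq; case. Qed.

Lemma gr_clsM i j a b (ia : F i a) (jb : F j b) (ijab : F (i + j)%N (a * b)) :
  gr_cls ia * gr_cls jb = gr_cls ijab.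
Proof.
rewrite -(@clsM gr_setoid); apply/clsP/greq => k /=.
have [ik|ki] := ltnP k i.
  rewrite big1 => [|l _]; last first.
    case: eqP => [li|_]; last by rewrite mul0r.
    by have := ltn_ord l; rewrite li ltnS leqNgt ik.
  by case: eqP => // kij; move: ik; rewrite kij ltnNge leq_addr.
have hi : (i < k.+1)%N by [].
rewrite (bigD1 (Ordinal hi)) //= eqxx big1 ?addr0.
  rewrite -(eqn_add2l i) subnKC //.
  by case: eqP => // _; rewrite mulr0.
move=> l; rewrite -val_eqE /= => /negPf ->; exact: mul0r.
Qed.

Lemma gr_cls_surj q : exists (n : nat) (a : nat -> A) (h : forall k, F k (a k)),
  q = \sum_(k < n) gr_cls (h k).
Proof.
case: (cls_surj q) => -[a ha [n han]] ->; exists n, a, ha.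
elim: n a ha han => [|n ih] a ha han.
  by rewrite big_ord0; apply/clsP/greq => k /=; exact: han.
rewrite big_ord_recr /=.
pose b k := if (k < n)%N then a k else 0.
have hb k : F k (b k) by rewrite /b; case: ifP => // _; exact: fl0.
have hbn k : (n <= k)%N -> b k = 0 by rewrite /b leqNgt => /negPf ->.
transitivity (@cls gr_setoid (@GrSeq b hb (ex_intro _ n hbn)) + gr_cls (ha n)).
  rewrite -(@clsD gr_setoid); apply/clsP/greq => k /=; rewrite /b.
  case: (ltngtP k n) => [kn|kn|->]; rewrite ?addr0 ?add0r //.
  exact: han.
congr (_ + _); rewrite ih; apply: eq_bigr => k _; apply: gr_cls_irr.
by rewrite /b ltn_ord.
Qed.

End AssociatedGraded.

Section GradedMap.
Variables (A B : pzRingType) (F : filtration A) (G : filtration B).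
Variable u : {rmorphism A -> B}.
Hypothesis uF : forall k a, F k a -> G k (u a).

Let f_seq (a : gr_seq F) : gr_seq G.
Proof.
exists (fun k => u (a k)); first by move=> k; exact/uF/gval_fl.
by case: (gval_fin a) => N h; exists N => k /h ->; exact: rmorph0.
Defined.

Let f (a : gr_setoid F) : gr G := @cls (gr_setoid G) (f_seq a).

Let f_eqv (a b : gr_setoid F) : seqv a b -> f a = f b.
Proof.
move=> ab; apply/gr_relP => k /=; rewrite -rmorphB; have := ab k.
by case: k => [|k] /=; [move=> ->; rewrite rmorph0|exact: uF].
Qed.

Let f1 : f (sone (gr_setoid F)) = 1.
Proof.
rewrite -(@cls1 (gr_setoid G)); apply: gr_seqP => -[|k] /=; first exact: rmorph1.
exact: rmorph0.
Qed.
Let fN a : f (sopp a) = - f a.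
Proof. by rewrite -(@clsN (gr_setoid G)); apply: gr_seqP => k /=; rewrite rmorphN. Qed.
Let fD a b : f (sadd a b) = f a + f b.
Proof. by rewrite -(@clsD (gr_setoid G)); apply: gr_seqP => k /=; rewrite rmorphD. Qed.
Let fM a b : f (smul a b) = f a * f b.
Proof.
rewrite -(@clsM (gr_setoid G)); apply: gr_seqP => k /=; rewrite rmorph_sum.
by apply: eq_bigr => i _; rewrite rmorphM.
Qed.

Definition gr_map : {rmorphism gr F -> gr G} := quot_map f_eqv f1 fN fD fM.

Lemma gr_map_cls k a (ka : F k a) : gr_map (gr_cls ka) = gr_cls (uF ka).
Proof.
rewrite /gr_map quot_mapE; apply: gr_seqP => j /=.
by case: eqP => // _; exact: rmorph0.
Qed.

End GradedMap.

Lemma gr_mor_ext (A B : pzRingType) (F : filtration A)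
    (u v : {rmorphism gr F -> B}) :
  (forall k a (h : F k a), u (gr_cls h) = v (gr_cls h)) -> u =1 v.
Proof.
move=> uv q; case: (gr_cls_surj q) => n [a [h ->]].
by rewrite !rmorph_sum; apply: eq_bigr => k _; exact: uv.
Qed.


Record opens (X : topologicalType) :=
  Opens { oset :> set X; oset_open : open oset }.

Definition opens_mem (X : topologicalType) (U : opens X) (x : X) : Prop :=
  oset U x.
Coercion opens_mem : opens >-> Funclass.

Definition opens_cap (X : topologicalType) (U V : opens X) : opens X :=
  Opens (openI (oset_open U) (oset_open V)).

Definition opens_top (X : topologicalType) : opens X := Opens (@openT X).

Record rpresheaf (X : topologicalType) := RPresheaf {
  psec :> opens X -> pzRingType;
  pres : forall U V : opens X, V `<=` U -> {rmorphism psec U -> psec V};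
  pres_id : forall (U : opens X) (h : U `<=` U) (s : psec U), pres h s = s;
  pres_comp : forall (U V W : opens X) (h : V `<=` U) (k : W `<=` V)
    (l : W `<=` U) (s : psec U), pres k (pres h s) = pres l s
}.

Arguments pres {X r U V} _.
Arguments pres_id {X r U} _ _.
Arguments pres_comp {X r U V W} _ _ _ _.

Definition is_sheaf (X : topologicalType) (F : rpresheaf X) : Prop :=
  (forall (U : opens X) (s t : F U),
     (forall x, U x -> exists (V : opens X) (h : V `<=` U),
        V x /\ pres h s = pres h t) -> s = t) /\
  (forall (U : opens X) (I : Type) (V : I -> opens X)
       (h : forall i, V i `<=` U) (s : forall i, F (V i)),
     (forall x, U x -> exists i, V i x) ->
     (forall i j (W : opens X) (hi : W `<=` V i) (hj : W `<=` V j),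
        pres hi (s i) = pres hj (s j)) ->
     exists t : F U, forall i, pres (h i) t = s i).

Record rpsh_mor (X : topologicalType) (F G : rpresheaf X) := RPshMor {
  rmap :> forall U : opens X, {rmorphism F U -> G U};
  rmapE : forall (U V : opens X) (h : V `<=` U) (s : F U),
    rmap V (pres h s) = pres h (rmap U s)
}.

Section Stalk.
Variables (X : topologicalType) (F : rpresheaf X).

Lemma pres_irr (U V : opens X) (h h' : V `<=` U) (s : F U) :
  pres h s = pres h' s.
Proof. by congr (pres _ s); exact: Prop_irrelevance. Qed.

Lemma pres_eq_sub (U V W W' : opens X) (hU : W `<=` U) (hV : W `<=` V)
    (kU : W' `<=` U) (kV : W' `<=` V) (s : F U) (t : F V) :
  W' `<=` W -> pres hU s = pres hV t -> pres kU s = pres kV t.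
Proof.
by move=> h e; rewrite -(pres_comp hU h kU) e (pres_comp hV h kV).
Qed.

Variable x : X.

Record germ_rep := GermRep { gdom : opens X; gdomx : gdom x; gsec : F gdom }.

Definition germ_rel (a b : germ_rep) : Prop :=
  exists (W : opens X) (h : W `<=` gdom a) (k : W `<=` gdom b),
    W x /\ pres h (gsec a) = pres k (gsec b).

Let subl (U V : opens X) : opens_cap U V `<=` U. Proof. exact: subIsetl. Qed.
Let subr (U V : opens X) : opens_cap U V `<=` V. Proof. exact: subIsetr. Qed.

Let zero := @GermRep (opens_top X) I 0.
Let one := @GermRep (opens_top X) I 1.
Let opp (a : germ_rep) := GermRep (gdomx a) (- gsec a).
Let add (a b : germ_rep) := @GermRep (opens_cap (gdom a) (gdom b))
  (conj (gdomx a) (gdomx b))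
  (pres (@subl _ _) (gsec a) + pres (@subr _ _) (gsec b)).
Let mul (a b : germ_rep) := @GermRep (opens_cap (gdom a) (gdom b))
  (conj (gdomx a) (gdomx b))
  (pres (@subl _ _) (gsec a) * pres (@subr _ _) (gsec b)).

Let presE (U V W : opens X) (h : V `<=` U) (k : W `<=` V) (s : F U) :
  pres k (pres h s) = pres (subset_trans k h) s.
Proof. exact: pres_comp. Qed.

Let addE (a b : germ_rep) (W : opens X) (h : W `<=` gdom (add a b))
    (ha : W `<=` gdom a) (hb : W `<=` gdom b) :
  pres h (gsec (add a b)) = pres ha (gsec a) + pres hb (gsec b).
Proof. by rewrite rmorphD !presE; congr (_ + _); exact: pres_irr. Qed.

Let mulE (a b : germ_rep) (W : opens X) (h : W `<=` gdom (mul a b))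
    (ha : W `<=` gdom a) (hb : W `<=` gdom b) :
  pres h (gsec (mul a b)) = pres ha (gsec a) * pres hb (gsec b).
Proof. by rewrite rmorphM !presE; congr (_ * _); exact: pres_irr. Qed.

Let oppE (a : germ_rep) (W : opens X) (h : W `<=` gdom (opp a))
    (ha : W `<=` gdom a) :
  pres h (gsec (opp a)) = - pres ha (gsec a).
Proof. by rewrite rmorphN; congr (- _); exact: pres_irr. Qed.

Let relI (W : opens X) (a b : germ_rep) : W x -> W `<=` gdom a ->
  W `<=` gdom b ->
  (forall (h : W `<=` gdom a) (k : W `<=` gdom b),
    pres h (gsec a) = pres k (gsec b)) -> germ_rel a b.
Proof. by move=> Wx h k e; exists W, h, k; split. Qed.

Let refl a : germ_rel a a.
Proof.
by apply: (@relI (gdom a)); [exact: gdomx| | |move=> h k; exact: pres_irr].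
Qed.
Let sym a b : germ_rel a b -> germ_rel b a.
Proof. by case=> W [h [k [Wx e]]]; exists W, k, h. Qed.
Let trans a b c : germ_rel a b -> germ_rel b c -> germ_rel a c.
Proof.
case=> W [h [k [Wx e]]] [W' [h' [k' [Wx' e']]]].
have wl := @subl W W'; have wr := @subr W W'.
apply: (@relI (opens_cap W W')); [by []|exact: subset_trans wl h| |].
  exact: subset_trans wr k'.
move=> p q; rewrite (pres_eq_sub p (subset_trans wl k) wl e).
exact: pres_eq_sub wr e'.
Qed.
Let opp_cong a a' : germ_rel a a' -> germ_rel (opp a) (opp a').
Proof.
by case=> W [h [k [Wx e]]]; exists W, h, k; split=> //; rewrite !rmorphN e.
Qed.
Let cap_sub (W W' U V : opens X) :
  W `<=` U -> W' `<=` V -> opens_cap W W' `<=` opens_cap U V.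
Proof. by move=> h h' y [/h ? /h' ?]. Qed.
Let add_cong a a' b b' :
  germ_rel a a' -> germ_rel b b' -> germ_rel (add a b) (add a' b').
Proof.
case=> W [h [k [Wx e]]] [W' [h' [k' [Wx' e']]]].
have wl := @subl W W'; have wr := @subr W W'.
apply: (@relI (opens_cap W W')); [by []|exact: cap_sub|exact: cap_sub|].
move=> p q.
rewrite (addE _ (subset_trans wl h) (subset_trans wr h')).
rewrite (addE _ (subset_trans wl k) (subset_trans wr k')).
by congr (_ + _); [exact: pres_eq_sub wl e|exact: pres_eq_sub wr e'].
Qed.
Let mul_cong a a' b b' :
  germ_rel a a' -> germ_rel b b' -> germ_rel (mul a b) (mul a' b').
Proof.
case=> W [h [k [Wx e]]] [W' [h' [k' [Wx' e']]]].
have wl := @subl W W'; have wr := @subr W W'.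
apply: (@relI (opens_cap W W')); [by []|exact: cap_sub|exact: cap_sub|].
move=> p q.
rewrite (mulE _ (subset_trans wl h) (subset_trans wr h')).
rewrite (mulE _ (subset_trans wl k) (subset_trans wr k')).
by congr (_ * _); [exact: pres_eq_sub wl e|exact: pres_eq_sub wr e'].
Qed.

Section Laws.
Variables a b c : germ_rep.
Let W := opens_cap (gdom a) (opens_cap (gdom b) (gdom c)).
Let Wx : W x. Proof. by split; [|split]; exact: gdomx. Qed.
Let Wa : W `<=` gdom a. Proof. by move=> y []. Qed.
Let Wb : W `<=` gdom b. Proof. by move=> y [? []]. Qed.
Let Wc : W `<=` gdom c. Proof. by move=> y [? []]. Qed.
Let Wab : W `<=` opens_cap (gdom a) (gdom b).
Proof. by move=> y [? []]. Qed.
Let Wac : W `<=` opens_cap (gdom a) (gdom c).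
Proof. by move=> y [? []]. Qed.
Let Wbc : W `<=` opens_cap (gdom b) (gdom c).
Proof. by move=> y [? []]. Qed.
Let Wca : W `<=` opens_cap (gdom c) (gdom a).
Proof. by move=> y [? []]. Qed.
Let Wcb : W `<=` opens_cap (gdom c) (gdom b).
Proof. by move=> y [? []]. Qed.

Let lawI (u v : germ_rep) : W `<=` gdom u -> W `<=` gdom v ->
  (forall (h : W `<=` gdom u) (k : W `<=` gdom v),
    pres h (gsec u) = pres k (gsec v)) -> germ_rel u v.
Proof. exact: relI. Qed.

Lemma germ_addA : germ_rel (add a (add b c)) (add (add a b) c).
Proof.
apply: lawI; [by move=> y [? []]|by move=> y [? []]|move=> p q].
rewrite (addE (b := add b c) _ Wa Wbc) (addE _ Wb Wc).
by rewrite (addE (a := add a b) _ Wab Wc) (addE _ Wa Wb) addrA.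
Qed.
Lemma germ_addC : germ_rel (add a b) (add b a).
Proof.
apply: lawI; [by move=> y [? []]|by move=> y [? []]|move=> p q].
by rewrite (addE _ Wa Wb) (addE _ Wb Wa) addrC.
Qed.
Lemma germ_add0 : germ_rel (add zero a) a.
Proof.
apply: lawI; [by move=> y [? []]|by move=> y [? []]|move=> p q].
by rewrite (addE (a := zero) _ (fun _ _ => I) q) rmorph0 add0r.
Qed.
Lemma germ_addN : germ_rel (add (opp a) a) zero.
Proof.
apply: lawI; [by move=> y [? []]|by move=> y [? []]|move=> p q].
by rewrite (addE (a := opp a) _ Wa Wa) (oppE _ Wa) rmorph0 addNr.
Qed.
Lemma germ_mulA : germ_rel (mul a (mul b c)) (mul (mul a b) c).
Proof.
apply: lawI; [by move=> y [? []]|by move=> y [? []]|move=> p q].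
rewrite (mulE (b := mul b c) _ Wa Wbc) (mulE _ Wb Wc).
by rewrite (mulE (a := mul a b) _ Wab Wc) (mulE _ Wa Wb) mulrA.
Qed.
Lemma germ_mul1l : germ_rel (mul one a) a.
Proof.
apply: lawI; [by move=> y [? []]|by move=> y [? []]|move=> p q].
by rewrite (mulE (a := one) _ (fun _ _ => I) q) rmorph1 mul1r.
Qed.
Lemma germ_mul1r : germ_rel (mul a one) a.
Proof.
apply: lawI; [by move=> y [? []]|by move=> y [? []]|move=> p q].
by rewrite (mulE (b := one) _ q (fun _ _ => I)) rmorph1 mulr1.
Qed.
Lemma germ_mulDl : germ_rel (mul (add a b) c) (add (mul a c) (mul b c)).
Proof.
apply: lawI; [by move=> y [? []]|by move=> y [? []]|move=> p q].
rewrite (mulE (a := add a b) _ Wab Wc) (addE _ Wa Wb)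
  (addE (a := mul a c) (b := mul b c) _ Wac Wbc) (mulE _ Wa Wc).
by rewrite (mulE _ Wb Wc) mulrDl.
Qed.
Lemma germ_mulDr : germ_rel (mul c (add a b)) (add (mul c a) (mul c b)).
Proof.
apply: lawI; [by move=> y [? []]|by move=> y [? []]|move=> p q].
rewrite (mulE (b := add a b) _ Wc Wab) (addE _ Wa Wb)
  (addE (a := mul c a) (b := mul c b) _ Wca Wcb) (mulE _ Wc Wa).
by rewrite (mulE _ Wc Wb) mulrDr.
Qed.
End Laws.

Definition stalk_setoid : setoid_ring :=
  SetoidRing refl sym trans opp_cong add_cong mul_cong
    germ_addA (fun a b => germ_addC a b a) (fun a => germ_add0 a a a)
    (fun a => germ_addN a a a) germ_mulA (fun a => germ_mul1l a a a)
    (fun a => germ_mul1r a a a) germ_mulDl germ_mulDr.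

Definition stalk : pzRingType := sring_quot stalk_setoid.

Definition germ (U : opens X) (Ux : U x) (s : F U) : stalk :=
  @cls stalk_setoid (GermRep Ux s).

Lemma germP (U V : opens X) (Ux : U x) (Vx : V x) (s : F U) (t : F V) :
  germ Ux s = germ Vx t <->
  exists (W : opens X) (h : W `<=` U) (k : W `<=` V),
    W x /\ pres h s = pres k t.
Proof. exact: clsP. Qed.

Lemma germ_pres (U V : opens X) (h : V `<=` U) (Ux : U x) (Vx : V x) (s : F U) :
  germ Vx (pres h s) = germ Ux s.
Proof.
apply/germP; exists V, (fun _ => id), h; split=> //.
exact: pres_id.
Qed.

Lemma germ_surj (q : stalk) :
  exists (U : opens X) (Ux : U x) (s : F U), q = germ Ux s.
Proof. by case: (cls_surj q) => -[U Ux s] ->; exists U, Ux, s. Qed.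

Lemma germD (U : opens X) (Ux : U x) (s t : F U) :
  germ Ux (s + t) = germ Ux s + germ Ux t.
Proof.
rewrite -(@clsD stalk_setoid); apply/clsP.
apply: (@relI U) => //= h k; rewrite (addE (a := GermRep Ux s)
  (b := GermRep Ux t) _ (fun _ => id) (fun _ => id)) !rmorphD.
by congr (_ + _); exact: pres_irr.
Qed.

Lemma germM (U : opens X) (Ux : U x) (s t : F U) :
  germ Ux (s * t) = germ Ux s * germ Ux t.
Proof.
rewrite -(@clsM stalk_setoid); apply/clsP.
apply: (@relI U) => //= h k; rewrite (mulE (a := GermRep Ux s)
  (b := GermRep Ux t) _ (fun _ => id) (fun _ => id)) !rmorphM.
by congr (_ * _); exact: pres_irr.
Qed.

Lemma germN (U : opens X) (Ux : U x) (s : F U) : germ Ux (- s) = - germ Ux s.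
Proof. by rewrite -(@clsN stalk_setoid). Qed.

Lemma germ1 (U : opens X) (Ux : U x) : germ Ux (1 : F U) = 1.
Proof.
rewrite -(@cls1 stalk_setoid); apply/clsP.
by apply: (@relI U) => //= h k; rewrite !rmorph1.
Qed.

Lemma germ0 (U : opens X) (Ux : U x) : germ Ux (0 : F U) = 0.
Proof.
rewrite -(@cls0 stalk_setoid); apply/clsP.
by apply: (@relI U) => //= h k; rewrite !rmorph0.
Qed.

End Stalk.

Section StalkMap.
Variables (X : topologicalType) (F G : rpresheaf X) (u : rpsh_mor F G).
Variable x : X.

Let f (a : stalk_setoid F x) : stalk G x := germ (gdomx a) (u (gdom a) (gsec a)).

Let f_eqv (a b : stalk_setoid F x) : seqv a b -> f a = f b.
Proof.
case=> W [h [k [Wx e]]]; apply/germP; exists W, h, k; split=> //.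
by rewrite -!rmapE e.
Qed.
Let f1 : f (sone (stalk_setoid F x)) = 1.
Proof. by rewrite /f rmorph1 germ1. Qed.
Let fN a : f (sopp a) = - f a.
Proof. by rewrite /f -germN -rmorphN. Qed.
Let fD a b : f (sadd a b) = f a + f b.
Proof. by rewrite /f /= rmorphD germD !rmapE
  (germ_pres _ (gdomx a)) (germ_pres _ (gdomx b)). Qed.
Let fM a b : f (smul a b) = f a * f b.
Proof. by rewrite /f /= rmorphM germM !rmapE
  (germ_pres _ (gdomx a)) (germ_pres _ (gdomx b)). Qed.

Definition stalk_map : {rmorphism stalk F x -> stalk G x} :=
  quot_map f_eqv f1 fN fD fM.

Lemma stalk_map_germ (U : opens X) (Ux : U x) (s : F U) :
  stalk_map (germ Ux s) = germ Ux (u U s).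
Proof. by rewrite /stalk_map quot_mapE. Qed.

End StalkMap.

(* The sheaf associated with a presheaf of rings: its sections over U are the
   families of germs at the points of U that are locally given by sections. *)
Section Sheafification.
Variables (X : topologicalType) (F : rpresheaf X).

Definition locally_section (U : opens X) (s : forall x, U x -> stalk F x) :=
  forall x (Ux : U x), exists (V : opens X) (h : V `<=` U) (t : F V),
    V x /\ forall y (Vy : V y), s y (h y Vy) = germ Vy t.

Record shf_sec (U : opens X) := ShfSec {
  shf_val :> forall x, U x -> stalk F x;
  shf_valP : locally_section shf_val
}.

Lemma shf_ext (U : opens X) (s t : shf_sec U) :
  (forall x (Ux : U x), s x Ux = t x Ux) -> s = t.
Proof.
case: s t => s sP [t tP] /= st; have e : s = t.
  apply functional_extensionality_dep => x.
  by apply functional_extensionality_dep => Ux; exact: st.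
by subst t; congr ShfSec; exact: Prop_irrelevance.
Qed.

Lemma shf_ext_loc (U : opens X) (s t : shf_sec U) :
  (forall x, U x -> exists (V : opens X) (h : V `<=` U),
     V x /\ forall y (Vy : V y), s y (h y Vy) = t y (h y Vy)) -> s = t.
Proof.
move=> st; apply: shf_ext => x Ux; case: (st x Ux) => V [h [Vx /(_ x Vx)]].
by rewrite (Prop_irrelevance (h x Vx) Ux).
Qed.

HB.instance Definition _ U := gen_eqMixin (shf_sec U).
HB.instance Definition _ U := gen_choiceMixin (shf_sec U).

Section Ring.
Variable U : opens X.

Definition shf_const (t : F U) : shf_sec U.
Proof.
by exists (fun x Ux => germ Ux t) => x Ux; exists U, (fun _ => id), t; split.
Defined.

Let opp (s : shf_sec U) : shf_sec U.
Proof.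
exists (fun x Ux => - s x Ux) => x Ux; case: (shf_valP s Ux) => V [h [t [Vx e]]].
by exists V, h, (- t); split=> // y Vy; rewrite e germN.
Defined.

Let loc2 (s t : shf_sec U) x (Ux : U x) :
  exists (V : opens X) (h : V `<=` U) (s' t' : F V), V x /\
    forall y (Vy : V y), s y (h y Vy) = germ Vy s' /\ t y (h y Vy) = germ Vy t'.
Proof.
case: (shf_valP s Ux) => V [h [s' [Vx e]]].
case: (shf_valP t Ux) => W [k [t' [Wx e']]].
pose V' := opens_cap V W.
have hV : V' `<=` V by exact: subIsetl.
have hW : V' `<=` W by exact: subIsetr.
exists V', (subset_trans hV h), (pres hV s'), (pres hW t'); split=> // y Vy.
rewrite (germ_pres _ (hV y Vy)) (germ_pres _ (hW y Vy)) -e -e'.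
by split; [congr (s y _)|congr (t y _)]; exact: Prop_irrelevance.
Qed.

Let add (s t : shf_sec U) : shf_sec U.
Proof.
exists (fun x Ux => s x Ux + t x Ux) => x Ux.
case: (loc2 s t Ux) => V [h [s' [t' [Vx e]]]]; exists V, h, (s' + t').
by split=> // y Vy; case: (e y Vy) => -> ->; rewrite germD.
Defined.

Let mul (s t : shf_sec U) : shf_sec U.
Proof.
exists (fun x Ux => s x Ux * t x Ux) => x Ux.
case: (loc2 s t Ux) => V [h [s' [t' [Vx e]]]]; exists V, h, (s' * t').
by split=> // y Vy; case: (e y Vy) => -> ->; rewrite germM.
Defined.

Let addA : associative add.
Proof. by move=> *; apply: shf_ext => x Ux /=; rewrite addrA. Qed.
Let addC : commutative add.
Proof. by move=> *; apply: shf_ext => x Ux /=; rewrite addrC. Qed.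
Let add0 : left_id (shf_const 0) add.
Proof. by move=> *; apply: shf_ext => x Ux /=; rewrite germ0 add0r. Qed.
Let addN : left_inverse (shf_const 0) opp add.
Proof. by move=> *; apply: shf_ext => x Ux /=; rewrite germ0 addNr. Qed.
Let mulA : associative mul.
Proof. by move=> *; apply: shf_ext => x Ux /=; rewrite mulrA. Qed.
Let mul1l : left_id (shf_const 1) mul.
Proof. by move=> *; apply: shf_ext => x Ux /=; rewrite germ1 mul1r. Qed.
Let mul1r : right_id (shf_const 1) mul.
Proof. by move=> *; apply: shf_ext => x Ux /=; rewrite germ1 mulr1. Qed.
Let mulDl : left_distributive mul add.
Proof. by move=> *; apply: shf_ext => x Ux /=; rewrite mulrDl. Qed.
Let mulDr : right_distributive mul add.
Proof. by move=> *; apply: shf_ext => x Ux /=; rewrite mulrDr. Qed.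

HB.instance Definition _ := GRing.isPzRing.Build (shf_sec U)
  addA addC add0 addN mulA mul1l mul1r mulDl mulDr.

Lemma shf_valD (s t : shf_sec U) x (Ux : U x) : (s + t) x Ux = s x Ux + t x Ux.
Proof. by []. Qed.
Lemma shf_valM (s t : shf_sec U) x (Ux : U x) : (s * t) x Ux = s x Ux * t x Ux.
Proof. by []. Qed.
Lemma shf_valN (s : shf_sec U) x (Ux : U x) : (- s) x Ux = - s x Ux.
Proof. by []. Qed.
Lemma shf_val1 x (Ux : U x) : (1 : shf_sec U) x Ux = 1.
Proof. exact: germ1. Qed.

Let constB : {morph shf_const : s t / s - t}.
Proof. by move=> s t; apply: shf_ext => x Ux /=; rewrite germD germN. Qed.
Let constM : monoid_morphism shf_const.
Proof. by split=> // s t; apply: shf_ext => x Ux /=; rewrite germM. Qed.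

Definition shf_unit0 : {rmorphism F U -> shf_sec U} := rmorph_of constB constM.

End Ring.

Section Restriction.
Variables (U V : opens X) (h : V `<=` U).

Definition shf_restrict (s : shf_sec U) : shf_sec V.
Proof.
exists (fun x Vx => s x (h Vx)) => x Vx; case: (shf_valP s (h Vx)).
move=> W [k [t [Wx e]]]; pose W' := opens_cap W V.
have hW : W' `<=` W by exact: subIsetl.
have hV : W' `<=` V by exact: subIsetr.
exists W', hV, (pres hW t); split=> // y Wy.
rewrite (germ_pres _ (hW y Wy)) -e.
by congr (s y _); exact: Prop_irrelevance.
Defined.

Let resB : {morph shf_restrict : s t / s - t}.
Proof. by move=> s t; exact: shf_ext. Qed.
Let resM : monoid_morphism shf_restrict.
Proof. by split=> [|s t]; apply: shf_ext => x Vx //=; rewrite !germ1. Qed.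

Definition shf_res : {rmorphism shf_sec U -> shf_sec V} := rmorph_of resB resM.

Lemma shf_resE (s : shf_sec U) x (Vx : V x) : shf_res s x Vx = s x (h Vx).
Proof. by []. Qed.

End Restriction.

Lemma shf_res_id (U : opens X) (h : U `<=` U) (s : shf_sec U) : shf_res h s = s.
Proof.
apply: shf_ext => x Ux; rewrite shf_resE.
by congr (s x _); exact: Prop_irrelevance.
Qed.

Lemma shf_res_comp (U V W : opens X) (h : V `<=` U) (k : W `<=` V)
  (l : W `<=` U) (s : shf_sec U) : shf_res k (shf_res h s) = shf_res l s.
Proof.
apply: shf_ext => x Ux; rewrite !shf_resE.
by congr (s x _); exact: Prop_irrelevance.
Qed.

Definition shf : rpresheaf X :=
  @RPresheaf X (fun U => shf_sec U) (fun U V h => shf_res h)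
    shf_res_id shf_res_comp.

Lemma shf_unitE (U V : opens X) (h : V `<=` U) (s : F U) :
  shf_unit0 V (pres h s) = shf_res h (shf_unit0 U s).
Proof. by apply: shf_ext => x Vx /=; rewrite (germ_pres _ (h x Vx)). Qed.

Definition shf_unit : rpsh_mor F shf := @RPshMor X F shf shf_unit0 shf_unitE.

Lemma shf_unit_val (U : opens X) (s : F U) x (Ux : U x) :
  (shf_unit U s : shf_sec U) x Ux = germ Ux s.
Proof. by []. Qed.

Lemma shf_locally_unit (U : opens X) (s : shf U) x : U x ->
  exists (V : opens X) (h : V `<=` U) (t : F V),
    V x /\ pres h s = shf_unit V t.
Proof.
move=> Ux; case: (shf_valP (s : shf_sec U) Ux) => V [h [t [Vx e]]].
by exists V, h, t; split=> //; apply: shf_ext => y Vy; rewrite shf_resE.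
Qed.

Lemma shf_separated (U : opens X) (s t : shf U) :
  (forall x, U x -> exists (V : opens X) (h : V `<=` U),
     V x /\ pres h s = pres h t) -> s = t.
Proof.
move=> st; apply: shf_ext_loc => x Ux; case: (st x Ux) => V [h [Vx e]].
exists V, h; split=> // y Vy.
exact: (congr1 (fun r : shf_sec V => r y Vy) e).
Qed.

Lemma shf_glue (U : opens X) (I : Type) (V : I -> opens X)
    (h : forall i, V i `<=` U) (s : forall i, shf (V i)) :
  (forall x, U x -> exists i, V i x) ->
  (forall i j (W : opens X) (hi : W `<=` V i) (hj : W `<=` V j),
     pres hi (s i) = pres hj (s j)) ->
  exists t : shf U, forall i, pres (h i) t = s i.
Proof.
move=> cov comp.
have ev i j x (Vi : V i x) (Vj : V j x) :
    (s i : shf_sec _) x Vi = (s j : shf_sec _) x Vj.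
  pose W := opens_cap (V i) (V j).
  have := comp i j W (@subIsetl _ _ _) (@subIsetr _ _ _).
  move=> /(congr1 (fun r : shf_sec W => r x (conj Vi Vj))).
  rewrite /pres /= (Prop_irrelevance (subIsetl _) Vi).
  by rewrite (Prop_irrelevance (subIsetr _) Vj).
pose ix x (Ux : U x) := projT1 (cid (cov x Ux)).
have ixP x (Ux : U x) : V (ix x Ux) x := projT2 (cid (cov x Ux)).
pose t x (Ux : U x) := (s (ix x Ux) : shf_sec _) x (ixP x Ux).
have tP : locally_section t.
  move=> x Ux; case: (shf_valP (s (ix x Ux) : shf_sec _) (ixP x Ux)).
  move=> W [k [r [Wx e]]]; exists W, (subset_trans k (h _)), r; split=> // y Wy.
  by rewrite -e; exact: ev.
exists (ShfSec tP) => i; apply: shf_ext => x Vx.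
exact: ev.
Qed.

Lemma shf_is_sheaf : is_sheaf shf.
Proof. by split; [exact: shf_separated|exact: shf_glue]. Qed.

End Sheafification.

Section SheafificationMap.
Variables (X : topologicalType) (F G : rpresheaf X) (u : rpsh_mor F G).

Section Sections.
Variable U : opens X.

Definition shf_map_fun (s : shf_sec F U) : shf_sec G U.
Proof.
exists (fun x Ux => stalk_map u x (s x Ux)) => x Ux.
case: (shf_valP s Ux) => V [h [t [Vx e]]]; exists V, h, (u V t); split=> // y Vy.
by rewrite e stalk_map_germ.
Defined.

Let mapB : {morph shf_map_fun : s t / s - t}.
Proof. by move=> s t; apply: shf_ext => x Ux; exact: rmorphB. Qed.
Let mapM : monoid_morphism shf_map_fun.
Proof.
split=> [|s t]; apply: shf_ext => x Ux; last exact: rmorphM.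
rewrite shf_val1 -(rmorph1 (stalk_map u x)).
by congr (stalk_map u x _); exact: shf_val1.
Qed.

Definition shf_map_sec : {rmorphism shf F U -> shf G U} :=
  @rmorph_of (shf F U) (shf G U) shf_map_fun mapB mapM.
End Sections.

Lemma shf_map_nat (U V : opens X) (h : V `<=` U) (s : shf F U) :
  shf_map_sec V (pres h s) = pres h (shf_map_sec U s).
Proof. exact: shf_ext. Qed.

Definition shf_map : rpsh_mor (shf F) (shf G) := RPshMor shf_map_nat.

Lemma shf_map_unit (U : opens X) (s : F U) :
  shf_map U (shf_unit F U s) = shf_unit G U (u U s).
Proof. by apply: shf_ext => x Ux /=; exact: stalk_map_germ. Qed.

End SheafificationMap.


Definition zariski_open (K : fieldType) (A : set K) : Prop :=
  exists S : set {poly K}, ~` A = [set z | forall p, S p -> root p z].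

Inductive base_field : forall K : fieldType, set (set K) -> Prop :=
| base_real (R : realType) : @base_field R (@open R)
| base_complex (R : realType) : @base_field R[i] (@open (R[i])^o)
| base_closed (k : closedFieldType) :
    [pchar k] =i pred0 -> @base_field k (@zariski_open k).

Lemma base_field_pchar0 (K : fieldType) (Kop : set (set K)) :
  base_field Kop -> [pchar K] =i pred0.
Proof.
by case=> // R; [exact: Num.Theory.pchar_num|exact: Num.Theory.pchar_num].
Qed.

Definition opens_incl (X : topologicalType) (U V : opens X) (h : V `<=` U)
    (x : set_type V) : set_type U :=
  exist _ (\val x) (mem_set (h _ (set_mem (valP x)))).

(* A sheaf of K-algebras of continuous K-valued functions. *)
Record ringed_space (K : fieldType) (Kop : set (set K)) (X : topologicalType) :=
RingedSpace {
  fsec : forall U : opens X, set (set_type U -> K);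
  fsec_cont : forall (U : opens X) (f : set_type U -> K), fsec f ->
    forall A, Kop A -> open (set_val @` (f @^-1` A));
  fsec_cst : forall (U : opens X) (c : K), fsec (cst c : set_type U -> K);
  fsecB : forall (U : opens X) (f g : set_type U -> K),
    fsec f -> fsec g -> fsec (f - g);
  fsecM : forall (U : opens X) (f g : set_type U -> K),
    fsec f -> fsec g -> fsec (f * g);
  fsec_res : forall (U V : opens X) (h : V `<=` U) (f : set_type U -> K),
    fsec f -> fsec (f \o opens_incl h : set_type V -> K);
  fsec_glue : forall (U : opens X) (f : set_type U -> K),
    (forall x, U x -> exists (V : opens X) (h : V `<=` U),
       V x /\ fsec (f \o opens_incl h : set_type V -> K)) -> fsec f
}.

Section StructureSheaf.
Variables (K : fieldType) (Kop : set (set K)) (X : topologicalType).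
Variable O : ringed_space Kop X.

Section Ring.
Variable U : opens X.

Definition fsec_pred : {pred (set_type U -> K)} :=
  fun f => f \in fsec O (U := U).

Lemma fsec_predP f : reflect (fsec O f) (f \in fsec_pred).
Proof. by rewrite unfold_in; apply: (iffP idP); rewrite in_setE. Qed.

Lemma fsec_subring : subring_closed fsec_pred.
Proof.
split=> [|f g /fsec_predP hf /fsec_predP hg|f g /fsec_predP hf /fsec_predP hg];
  apply/fsec_predP; [exact: fsec_cst|exact: fsecB|exact: fsecM].
Qed.

Record osec := OSec { oval :> set_type U -> K; ovalP : oval \in fsec_pred }.

HB.instance Definition _ := [isSub for oval].
HB.instance Definition _ := [Choice of osec by <:].
HB.instance Definition _ :=
  GRing.SubChoice_isSubComPzRing.Build _ _ osec fsec_subring.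

Definition ocst (c : K) : osec := OSec (introT (fsec_predP _) (fsec_cst O U c)).

End Ring.

Section Restriction.
Variables (U V : opens X) (h : V `<=` U).

Definition ores0 (f : osec U) : osec V :=
  OSec (introT (fsec_predP _) (fsec_res h (elimT (fsec_predP _) (ovalP f)))).

Lemma ores0B : {morph ores0 : f g / f - g}.
Proof. by move=> f g; apply: val_inj. Qed.
Lemma ores0M : monoid_morphism ores0.
Proof. by split=> [|f g]; apply: val_inj. Qed.

Definition ores : {rmorphism osec U -> osec V} := rmorph_of ores0B ores0M.

End Restriction.

Lemma ores_id (U : opens X) (h : U `<=` U) (f : osec U) : ores h f = f.
Proof.
by apply/val_inj/funext => x /=; congr (oval f _); exact: val_inj.
Qed.

Lemma ores_comp (U V W : opens X) (h : V `<=` U) (k : W `<=` V) (l : W `<=` U)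
  (f : osec U) : ores k (ores h f) = ores l f.
Proof.
by apply/val_inj/funext => x /=; congr (oval f _); exact: val_inj.
Qed.

Lemma ores_cst (U V : opens X) (h : V `<=` U) c :
  ores h (ocst U c) = ocst V c.
Proof. exact: val_inj. Qed.

Definition osheaf : rpresheaf X :=
  @RPresheaf X (fun U => osec U) (fun U V h => ores h) ores_id ores_comp.

(* A section over U of the sheaf of K-linear derivations of O: a derivation of
   the restriction of the sheaf O to U. *)
Record tangent (U : opens X) := Tangent {
  der :> forall V : opens X, V `<=` U -> osec V -> osec V;
  der_lin : forall (V : opens X) (h : V `<=` U) c f g,
    der h (ocst V c * f + g) = ocst V c * der h f + der h g;
  derM : forall (V : opens X) (h : V `<=` U) f g,
    der h (f * g) = der h f * g + f * der h g;
  der_res : forall (V W : opens X) (h : V `<=` U) (k : W `<=` V) (l : W `<=` U)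
    f, ores k (der h f) = der l (ores k f)
}.

Record omodule := OModule {
  msec :> forall U : opens X, lmodType (osec U);
  mres : forall U V : opens X, V `<=` U -> msec U -> msec V;
  mresD : forall (U V : opens X) (h : V `<=` U) (s t : msec U),
    mres h (s + t) = mres h s + mres h t;
  mresZ : forall (U V : opens X) (h : V `<=` U) (f : osec U) (s : msec U),
    mres h (f *: s) = ores h f *: mres h s;
  mres_id : forall (U : opens X) (h : U `<=` U) (s : msec U), mres h s = s;
  mres_comp : forall (U V W : opens X) (h : V `<=` U) (k : W `<=` V)
    (l : W `<=` U) (s : msec U), mres k (mres h s) = mres l s;
  msep : forall (U : opens X) (s t : msec U),
    (forall x, U x -> exists (V : opens X) (h : V `<=` U),
       V x /\ mres h s = mres h t) -> s = t;
  mglue : forall (U : opens X) (I : Type) (V : I -> opens X)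
      (h : forall i, V i `<=` U) (s : forall i, msec (V i)),
    (forall x, U x -> exists i, V i x) ->
    (forall i j (W : opens X) (hi : W `<=` V i) (hj : W `<=` V j),
       mres hi (s i) = mres hj (s j)) ->
    exists t : msec U, forall i, mres (h i) t = s i
}.

(* Every point has an open neighbourhood U over which L is isomorphic to a
   direct sum of copies of O, of finite or infinite rank: there are sections
   e i over U that are linearly independent over each open V in U, and each
   section over V is locally a linear combination of the e i. *)
Definition locally_free (L : omodule) : Prop :=
  forall x : X, exists U : opens X, U x /\
  exists (I : choiceType) (e : I -> L U),
  forall (V : opens X) (h : V `<=` U),
    (forall (r : seq I) (c : I -> osec V), uniq r ->
       \sum_(i <- r) c i *: mres h (e i) = 0 -> forall i, i \in r -> c i = 0) /\
    (forall (s : L V) y, V y ->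
       exists (W : opens X) (k : W `<=` V) (l : W `<=` U) (r : seq I)
         (c : I -> osec W),
         W y /\ mres k s = \sum_(i <- r) c i *: mres l (e i)).

(* L is a sheaf of K-Lie algebras for the K-structure given by the constant
   functions; anchor is the O-linear Lie algebra homomorphism to the sheaf of
   derivations. *)
Record lie_algebroid := LieAlgebroid {
  lmod :> omodule;
  br : forall U : opens X, lmod U -> lmod U -> lmod U;
  br_linl : forall (U : opens X) c (D E F : lmod U),
    br (ocst U c *: D + E) F = ocst U c *: br D F + br E F;
  br_linr : forall (U : opens X) c (D E F : lmod U),
    br F (ocst U c *: D + E) = ocst U c *: br F D + br F E;
  br_alt : forall (U : opens X) (D : lmod U), br D D = 0;
  br_jacobi : forall (U : opens X) (D E F : lmod U),
    br D (br E F) + br E (br F D) + br F (br D E) = 0;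
  br_res : forall (U V : opens X) (h : V `<=` U) (D E : lmod U),
    mres h (br D E) = br (mres h D) (mres h E);
  anchor : forall U : opens X, lmod U -> tangent U;
  anchor_res : forall (U V W : opens X) (h : V `<=` U) (k : W `<=` V)
      (l : W `<=` U) (D : lmod U) f,
    anchor (mres h D) W k f = anchor D W l f;
  anchor_lin : forall (U V : opens X) (h : V `<=` U) g (D E : lmod U) f,
    anchor (g *: D + E) V h f = ores h g * anchor D V h f + anchor E V h f;
  anchor_br : forall (U V : opens X) (h : V `<=` U) (D E : lmod U) f,
    anchor (br D E) V h f =
    anchor D V h (anchor E V h f) - anchor E V h (anchor D V h f);
  br_leibniz : forall (U : opens X) (h : U `<=` U) (D E : lmod U) f,
    br D (f *: E) = f *: br D E + anchor D U h f *: E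
}.

Record omodule_mor (M L : omodule) := OModuleMor {
  mmap :> forall U : opens X, M U -> L U;
  mmap_lin : forall (U : opens X) f (D E : M U),
    mmap (f *: D + E) = f *: mmap D + mmap E;
  mmap_res : forall (U V : opens X) (h : V `<=` U) (D : M U),
    mmap (mres h D) = mres h (mmap D)
}.

Record lie_morphism (M L : lie_algebroid) := LieMorphism {
  lmap :> omodule_mor M L;
  lmap_br : forall (U : opens X) (D E : M U),
    lmap U (br D E) = br (lmap U D) (lmap U E);
  lmap_anchor : forall (U V : opens X) (h : V `<=` U) (D : M U) f,
    anchor (lmap U D) V h f = anchor D V h f
}.

End StructureSheaf.

Arguments ores {K Kop X O U V} _.
Arguments ores_id {K Kop X O U} _ _.
Arguments ores_comp {K Kop X O U V W} _ _ _ _.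
Arguments ocst {K Kop X O} U c.
Arguments mres {K Kop X O o U V} _ _.
Arguments mresD {K Kop X O o U V} _ _ _.
Arguments mresZ {K Kop X O o U V} _ _ _.
Arguments mres_id {K Kop X O o U} _ _.
Arguments mres_comp {K Kop X O o U V W} _ _ _ _.
Arguments der_res {K Kop X O U} _ {V W} _ _ _ _.
Arguments anchor {K Kop X O _ U} _.
Arguments anchor_res {K Kop X O _ U V W} _ _ _ _ _.
Arguments mmap_res {K Kop X O M L} _ {U V} _ _.

Section EnvelopingMap.
Variables (R S : comPzRingType) (L : lmodType R) (M : lmodType S).
Variables (brL : L -> L -> L) (actL : L -> R -> R).
Variables (brM : M -> M -> M) (actM : M -> S -> S).
Variables (rho : {rmorphism R -> S}) (phi : L -> M).
Hypothesis phiD : forall D E, phi (D + E) = phi D + phi E.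
Hypothesis phiZ : forall f D, phi (f *: D) = rho f *: phi D.
Hypothesis phi_br : forall D E, phi (brL D E) = brM (phi D) (phi E).
Hypothesis phi_act : forall D f, rho (actL D f) = actM (phi D) (rho f).

Lemma env_map_compat :
  env_compat brL actL (env_scal brM actM \o rho : {rmorphism R -> _})
    (fun D => env_vec brM actM (phi D)).
Proof.
split=> *.
- by rewrite phiD env_vecDE.
- by rewrite phiZ env_vecZE.
- by rewrite env_vec_commE phi_br.
- by rewrite /= env_scal_commE phi_act.
Qed.

Definition env_map : {rmorphism env brL actL -> env brM actM} :=
  env_lift env_map_compat.

Lemma env_map_scal f :
  env_map (env_scal brL actL f) = env_scal brM actM (rho f).
Proof. exact: env_lift_scal. Qed.

Lemma env_map_vec D : env_map (env_vec brL actL D) = env_vec brM actM (phi D).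
Proof. exact: env_lift_vec. Qed.

End EnvelopingMap.

Section EnvelopingSheaf.
Variables (K : fieldType) (Kop : set (set K)) (X : topologicalType).
Variable O : ringed_space Kop X.

(* Commutators for the generators of an algebra over O. *)
Record comm_data (L : omodule O) := CommData {
  cbr : forall U : opens X, L U -> L U -> L U;
  cact : forall U : opens X, L U -> osec O U -> osec O U;
  cbr_res : forall (U V : opens X) (h : V `<=` U) (D E : L U),
    mres h (cbr D E) = cbr (mres h D) (mres h E);
  cact_res : forall (U V : opens X) (h : V `<=` U) (D : L U) f,
    ores h (cact D f) = cact (mres h D) (ores h f)
}.

Arguments cbr {L} _ {U} _ _.
Arguments cact {L} _ {U} _ _.

Section Presheaf.
Variables (L : omodule O) (c : comm_data L).

Definition env_psec (U : opens X) : pzRingType := env (@cbr L c U) (@cact L c U).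

Definition env_pres (U V : opens X) (h : V `<=` U) :
    {rmorphism env_psec U -> env_psec V} :=
  env_map (mresD h) (mresZ h) (cbr_res c h) (cact_res c h).

Lemma env_pres_scal (U V : opens X) (h : V `<=` U) f :
  env_pres h (env_scal _ _ f) = env_scal _ _ (ores h f).
Proof. exact: env_map_scal. Qed.

Lemma env_pres_vec (U V : opens X) (h : V `<=` U) D :
  env_pres h (env_vec _ _ D) = env_vec _ _ (mres h D).
Proof. exact: env_map_vec. Qed.

Lemma env_pres_id (U : opens X) (h : U `<=` U) (s : env_psec U) :
  env_pres h s = s.
Proof.
apply: (@env_mor_ext _ _ _ _ _ (env_pres h) idfun) => [f|D].
- by apply: etrans (env_pres_scal h f) _; rewrite ores_id.
- by apply: etrans (env_pres_vec h D) _; rewrite mres_id.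
Qed.

Lemma env_pres_comp (U V W : opens X) (h : V `<=` U) (k : W `<=` V)
  (l : W `<=` U) (s : env_psec U) : env_pres k (env_pres h s) = env_pres l s.
Proof.
apply: (@env_mor_ext _ _ _ _ _ (env_pres k \o env_pres h) (env_pres l))
  => [f|D].
- apply: etrans (congr1 (env_pres k) (env_pres_scal h f)) _.
  apply: etrans (env_pres_scal k _) _; rewrite (ores_comp h k l).
  by apply/esym; exact: env_pres_scal.
- apply: etrans (congr1 (env_pres k) (env_pres_vec h D)) _.
  apply: etrans (env_pres_vec k _) _; rewrite (mres_comp h k l).
  by apply/esym; exact: env_pres_vec.
Qed.

Definition env_presheaf : rpresheaf X :=
  @RPresheaf X env_psec env_pres env_pres_id env_pres_comp.

Definition env_sheaf : rpresheaf X := shf env_presheaf.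

Definition es_scal (U : opens X) : {rmorphism osec O U -> env_sheaf U} :=
  shf_unit env_presheaf U \o env_scal (@cbr L c U) (@cact L c U).

Definition es_vec (U : opens X) (D : L U) : env_sheaf U :=
  shf_unit env_presheaf U (env_vec (@cbr L c U) (@cact L c U) D).

Lemma es_scal_res (U V : opens X) (h : V `<=` U) f :
  pres h (es_scal U f) = es_scal V (ores h f).
Proof.
apply: etrans (esym (rmapE (shf_unit env_presheaf) h _)) _.
by congr (shf_unit _ _ _); exact: env_pres_scal.
Qed.

Lemma es_vec_res (U V : opens X) (h : V `<=` U) (D : L U) :
  pres h (es_vec D) = es_vec (mres h D).
Proof.
apply: etrans (esym (rmapE (shf_unit env_presheaf) h _)) _.
by congr (shf_unit _ _ _); exact: env_pres_vec.
Qed.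

Lemma es_vecD (U : opens X) (D E : L U) : es_vec (D + E) = es_vec D + es_vec E.
Proof. by rewrite /es_vec env_vecDE rmorphD. Qed.

Lemma es_vecZ (U : opens X) f (D : L U) :
  es_vec (f *: D) = es_scal U f * es_vec D.
Proof. by rewrite /es_vec env_vecZE rmorphM. Qed.

Lemma es_vec_comm (U : opens X) (D E : L U) :
  es_vec D * es_vec E - es_vec E * es_vec D = es_vec (cbr c D E).
Proof. by rewrite /es_vec -env_vec_commE rmorphB !rmorphM. Qed.

Lemma es_scal_comm (U : opens X) (D : L U) f :
  es_vec D * es_scal U f - es_scal U f * es_vec D = es_scal U (cact c D f).
Proof.
have := congr1 (shf_unit env_presheaf U)
  (env_scal_commE (@cbr L c U) (@cact L c U) D f).
by rewrite rmorphB !rmorphM.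
Qed.

(* Sections that are locally finite sums of terms f D_1 ... D_m with P m. *)
Definition word (U : opens X) (p : osec O U * seq (L U)) : env_sheaf U :=
  es_scal U p.1 * \prod_(D <- p.2) es_vec D.

Definition word_span (P : pred nat) (U : opens X) (s : env_sheaf U) : Prop :=
  exists ps : seq (osec O U * seq (L U)),
    all (fun p => P (size p.2)) ps /\ s = \sum_(p <- ps) word p.

Definition loc_word_span (P : pred nat) (U : opens X) (s : env_sheaf U) : Prop :=
  forall x, U x -> exists (V : opens X) (h : V `<=` U),
    V x /\ word_span P (pres h s).

End Presheaf.

Definition sym_comm (L : omodule O) : comm_data L.
Proof.
exists (fun _ _ _ => 0) (fun _ _ _ => 0).
- by move=> U V h _ _; rewrite -(scale0r 0) mresZ rmorph0 scale0r.
- by move=> *; rewrite rmorph0.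
Defined.

Definition lie_comm (L : lie_algebroid O) : comm_data L.
Proof.
exists (@br _ _ _ _ L) (fun U D f => anchor D U (@subset_refl _ U) f).
- exact: br_res.
- move=> U V h D f; rewrite (anchor_res _ _ h); exact: der_res.
Defined.

End EnvelopingSheaf.

Section Filtration.
Variables (K : fieldType) (Kop : set (set K)) (X : topologicalType).
Variable O : ringed_space Kop X.
Variables (L : omodule O) (c : comm_data L).

Lemma word_res (U V : opens X) (h : V `<=` U) (p : osec O U * seq (L U)) :
  pres h (word c p) = word c (ores h p.1, map (mres h) p.2).
Proof.
rewrite /word rmorphM rmorph_prod es_scal_res big_map /=.
by congr (_ * _); apply: eq_bigr => D _; exact: es_vec_res.
Qed.

Section Span.
Variable U : opens X.
Implicit Types s t : env_sheaf c U.

Lemma word_span_sub (P Q : pred nat) s :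
  (forall n, P n -> Q n) -> word_span P s -> word_span Q s.
Proof.
move=> PQ [ps [/allP h ->]]; exists ps; split=> //.
by apply/allP => p /h; exact: PQ.
Qed.

Lemma word_span0 P : word_span (c := c) (U := U) P 0.
Proof. by exists [::]; split=> //; rewrite big_nil. Qed.

Lemma word_spanD P s t : word_span P s -> word_span P t -> word_span P (s + t).
Proof.
move=> [ps [h ->]] [qs [k ->]]; exists (ps ++ qs).
by rewrite all_cat h k big_cat.
Qed.

Lemma word_span_word (P : pred nat) (p : osec O U * seq (L U)) :
  P (size p.2) -> word_span P (word c p).
Proof. by move=> h; exists [:: p]; split; rewrite ?big_seq1 //= h. Qed.

Lemma word_span_map (P Q : pred nat) (u : env_sheaf c U -> env_sheaf c U) s :
  u 0 = 0 -> (forall a b, u (a + b) = u a + u b) ->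
  (forall p : osec O U * seq (L U),
     P (size p.2) -> word_span Q (u (word c p))) ->
  word_span P s -> word_span Q (u s).
Proof.
move=> u0 uD uw [ps [h ->]]; elim: ps h => [|p ps ih] /=.
  by rewrite big_nil u0 => _; exact: word_span0.
case/andP=> hp /ih hps; rewrite big_cons uD.
by apply: word_spanD => //; exact: uw.
Qed.

Lemma word_span_scal P f s :
  word_span P s -> word_span P (es_scal c U f * s).
Proof.
apply: (word_span_map (u := fun s => es_scal c U f * s)) => [|a b|p hp].
- exact: mulr0.
- exact: mulrDr.
- rewrite /word mulrA -rmorphM.
  exact: (@word_span_word P (f * p.1, p.2)).
Qed.

Lemma word_spanN P s : word_span P s -> word_span P (- s).
Proof.
by move=> /(word_span_scal (-1)); rewrite rmorphN rmorph1 mulN1r.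
Qed.

Lemma word_span_vec k D s :
  word_span (leq^~ k) s -> word_span (leq^~ k.+1) (es_vec c D * s).
Proof.
apply: (word_span_map (u := fun s => es_vec c D * s)) => [|a b|p hp].
- exact: mulr0.
- exact: mulrDr.
- have e : es_vec c D * es_scal c U p.1 =
      es_scal c U p.1 * es_vec c D + es_scal c U (cact c D p.1).
    by rewrite -es_scal_comm addrC subrK.
  rewrite /word mulrA e mulrDl -mulrA; apply: word_spanD.
  + have := @word_span_word (leq^~ k.+1) (p.1, D :: p.2).
    by rewrite /word big_cons; apply.
  + by apply: (@word_span_word (leq^~ k.+1) (_, p.2)); exact: leqW.
Qed.

Lemma word_span_prodr k s (w : seq (L U)) :
  word_span (leq^~ k) s ->
  word_span (leq^~ (k + size w)%N) (s * \prod_(D <- w) es_vec c D).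
Proof.
apply: (word_span_map (u := fun s => s * \prod_(D <- w) es_vec c D))
  => [|a b|p hp].
- exact: mul0r.
- exact: mulrDl.
- rewrite /word -mulrA -big_cat.
  apply: (@word_span_word _ (_, p.2 ++ w)).
  by rewrite /= size_cat leq_add2r.
Qed.

Lemma word_span_prod_scal (w : seq (L U)) f :
  word_span (leq^~ (size w)) (\prod_(D <- w) es_vec c D * es_scal c U f).
Proof.
elim: w => [|D w ih].
  rewrite big_nil mul1r -[es_scal c U f]mulr1.
  by have := @word_span_word (leq^~ 0%N) (f, [::]); rewrite /word big_nil; apply.
by rewrite big_cons -mulrA; exact: word_span_vec.
Qed.

Lemma word_spanM i j s t : word_span (leq^~ i) s -> word_span (leq^~ j) t ->
  word_span (leq^~ (i + j)%N) (s * t).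
Proof.
move=> hs ht; move: hs.
apply: (word_span_map (u := fun s => s * t)) => [|a b|p hp].
- exact: mul0r.
- exact: mulrDl.
move: ht; apply: (word_span_map (u := fun t => word c p * t)) => [|a b|q hq].
- exact: mulr0.
- exact: mulrDr.
rewrite /word -mulrA; apply: word_span_scal; rewrite mulrA.
apply: (@word_span_sub (leq^~ (size p.2 + size q.2)%N)).
  by move=> n h; apply: leq_trans h _; exact: leq_add.
by apply: word_span_prodr; exact: word_span_prod_scal.
Qed.

Lemma word_span1 k : word_span (c := c) (U := U) (leq^~ k) 1.
Proof.
have := @word_span_word (leq^~ k) (1, [::]).
by rewrite /word big_nil rmorph1 mulr1; apply.
Qed.

End Span.

Lemma word_span_res P (U V : opens X) (h : V `<=` U) (s : env_sheaf c U) :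
  word_span P s -> word_span P (pres h s).
Proof.
move=> [ps [k ->]]; exists [seq (ores h p.1, map (mres h) p.2) | p <- ps].
split; first by rewrite all_map; apply: sub_all k => p /=; rewrite size_map.
by rewrite rmorph_sum big_map; apply: eq_bigr => p _; exact: word_res.
Qed.

Lemma loc_word_span_of P (U : opens X) (s : env_sheaf c U) :
  word_span P s -> loc_word_span P s.
Proof.
move=> h x Ux; exists U, (@subset_refl _ U); split=> //.
exact: word_span_res.
Qed.

Lemma loc_word_span_res P (U V : opens X) (h : V `<=` U) (s : env_sheaf c U) :
  loc_word_span P s -> loc_word_span P (pres h s).
Proof.
move=> k x Vx; case: (k x (h x Vx)) => W [l [Wx ws]].
pose W' := opens_cap W V.
have hW : W' `<=` W by exact: subIsetl.
have hV : W' `<=` V by exact: subIsetr.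
exists W', hV; split=> //; rewrite (pres_comp h hV (subset_trans hW l)).
by rewrite -(pres_comp l hW); exact: word_span_res.
Qed.

Lemma loc_word_span2 P Q R (U : opens X) (s t r : env_sheaf c U) :
  (forall (V : opens X) (h : V `<=` U), word_span P (pres h s) ->
     word_span Q (pres h t) -> word_span R (pres h r)) ->
  loc_word_span P s -> loc_word_span Q t -> loc_word_span R r.
Proof.
move=> H hs ht x Ux; case: (hs x Ux) => V [h [Vx hV]].
case: (ht x Ux) => W [k [Wx hW]]; pose W' := opens_cap V W.
have lV : W' `<=` V by exact: subIsetl.
have lW : W' `<=` W by exact: subIsetr.
exists W', (subset_trans lV h); split=> //; apply: H.
- by rewrite -(pres_comp h lV); exact: word_span_res.
- by rewrite -(pres_comp k lW); exact: word_span_res.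
Qed.

(* The subsheaf spanned by O and the powers of L of order at most k. *)
Definition env_filt (U : opens X) : filtration (env_sheaf c U).
Proof.
apply: (@Filtration _ (fun k => loc_word_span (leq^~ k) (U := U))).
- by apply: loc_word_span_of; exact: word_span1.
- move=> k s t; apply: loc_word_span2 => V h hs ht.
  by rewrite rmorphB; apply: word_spanD => //; exact: word_spanN.
- move=> k s hs x /hs [V [h [Vx hV]]]; exists V, h; split=> //.
  by apply: word_span_sub hV => n; exact: leqW.
- move=> i j s t; apply: loc_word_span2 => V h hs ht.
  by rewrite rmorphM; exact: word_spanM.
Defined.

Lemma env_filt_scal (U : opens X) f : env_filt U 0 (es_scal c U f).
Proof.
apply: loc_word_span_of; have := @word_span_word U (leq^~ 0%N) (f, [::]).
by rewrite /word big_nil mulr1; apply.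
Qed.

Lemma env_filt_vec (U : opens X) D : env_filt U 1 (es_vec c (U := U) D).
Proof.
apply: loc_word_span_of; have := @word_span_word U (leq^~ 1%N) (1, [:: D]).
by rewrite /word big_seq1 rmorph1 mul1r; apply.
Qed.

Lemma env_filt_prod (U : opens X) k (D : 'I_k -> L U) :
  env_filt U k (\prod_(i < k) es_vec c (D i)).
Proof.
apply: loc_word_span_of.
have := @word_span_word U (leq^~ k) (1, [seq D i | i <- index_enum 'I_k]).
rewrite /word size_map big_map rmorph1 mul1r; apply.
by rewrite -[k in X in (_ <= X)%N]size_enum_ord enumT /index_enum unlock.
Qed.

Lemma env_filt_res (U V : opens X) (h : V `<=` U) k (s : env_sheaf c U) :
  env_filt U k s -> env_filt V k (pres h s).
Proof. exact: loc_word_span_res. Qed.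

Definition env_gr (U : opens X) : pzRingType := gr (env_filt U).

Definition env_gr_res (U V : opens X) (h : V `<=` U) :
    {rmorphism env_gr U -> env_gr V} :=
  gr_map (env_filt_res h).

Lemma env_gr_res_id (U : opens X) (h : U `<=` U) (s : env_gr U) :
  env_gr_res h s = s.
Proof.
apply: (gr_mor_ext (u := env_gr_res h) (v := idfun)) => k a ka.
by apply: etrans (gr_map_cls _ _) _; apply: gr_cls_irr; exact: pres_id.
Qed.

Lemma env_gr_res_comp (U V W : opens X) (h : V `<=` U) (k : W `<=` V)
  (l : W `<=` U) (s : env_gr U) : env_gr_res k (env_gr_res h s) = env_gr_res l s.
Proof.
apply: (gr_mor_ext (u := env_gr_res k \o env_gr_res h)) => i a ia.
apply: etrans (congr1 (env_gr_res k) (gr_map_cls _ _)) _.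
apply: etrans (gr_map_cls _ _) (esym _); apply: etrans (gr_map_cls _ _) _.
by apply: gr_cls_irr; apply/esym; exact: pres_comp.
Qed.

Definition env_gr_presheaf : rpresheaf X :=
  @RPresheaf X env_gr env_gr_res env_gr_res_id env_gr_res_comp.

Definition env_gr_sheaf : rpresheaf X := shf env_gr_presheaf.

Definition eg_cls (U : opens X) (k : nat) (a : env_sheaf c U)
    (ka : env_filt U k a) : env_gr_sheaf U :=
  shf_unit env_gr_presheaf U (gr_cls ka).

Let eg_scal0 (U : opens X) (f : osec O U) : env_gr U :=
  gr_cls (env_filt_scal f).

Let eg_scal0B (U : opens X) : {morph @eg_scal0 U : f g / f - g}.
Proof.
move=> f g; rewrite /eg_scal0.
have h : env_filt U 0%N (- es_scal c U g) by exact/flN/env_filt_scal.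
have k : env_filt U 0%N (es_scal c U f - es_scal c U g).
  by apply: flB; exact: env_filt_scal.
by rewrite (gr_clsN _ h) (gr_clsD _ _ k); apply: gr_cls_irr; exact: rmorphB.
Qed.

Let eg_scal0M (U : opens X) : monoid_morphism (@eg_scal0 U).
Proof.
split=> [|f g].
  rewrite -(gr_cls1 (fl1 (env_filt U))); apply: gr_cls_irr; exact: rmorph1.
have k : env_filt U (0 + 0)%N (es_scal c U f * es_scal c U g).
  by apply: flM; exact: env_filt_scal.
by rewrite /eg_scal0 (gr_clsM _ _ k); apply: gr_cls_irr; exact: rmorphM.
Qed.

Definition eg_scal_pre (U : opens X) : {rmorphism osec O U -> env_gr U} :=
  rmorph_of (@eg_scal0B U) (@eg_scal0M U).

Lemma eg_scal_preE (U : opens X) f :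
  eg_scal_pre U f = gr_cls (env_filt_scal f).
Proof. by []. Qed.

Definition eg_scal (U : opens X) : {rmorphism osec O U -> env_gr_sheaf U} :=
  shf_unit env_gr_presheaf U \o eg_scal_pre U.

Lemma eg_cls_res (U V : opens X) (h : V `<=` U) k (a : env_sheaf c U)
    (ka : env_filt U k a) :
  pres h (eg_cls ka) = eg_cls (env_filt_res h ka).
Proof.
apply: etrans (esym (rmapE (shf_unit env_gr_presheaf) h _)) _.
by congr (shf_unit _ _ _); exact: gr_map_cls.
Qed.

Lemma eg_scal_res (U V : opens X) (h : V `<=` U) f :
  pres h (eg_scal U f) = eg_scal V (ores h f).
Proof.
apply: etrans (eg_cls_res _ _) _; congr (shf_unit _ _ _).
by apply: gr_cls_irr; exact: es_scal_res.
Qed.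

End Filtration.

Section GradedAlgebras.
Variables (K : fieldType) (Kop : set (set K)) (X : topologicalType).
Variable O : ringed_space Kop X.

(* A sheaf of O-algebras with its homogeneous sections of each degree; that the
   sheaf is the direct sum of its homogeneous parts is not among the fields. *)
Record graded_oalg := GradedOAlg {
  galg :> rpresheaf X;
  galg_sheaf : is_sheaf galg;
  gunit : forall U : opens X, {rmorphism osec O U -> galg U};
  gunit_res : forall (U V : opens X) (h : V `<=` U) f,
    pres h (gunit U f) = gunit V (ores h f);
  gdeg : nat -> forall U : opens X, set (galg U)
}.

Record graded_mor (A B : graded_oalg) := GradedMor {
  gmor :> rpsh_mor A B;
  gmor_unit : forall (U : opens X) f, gmor U (gunit A U f) = gunit B U f;
  gmor_deg : forall k (U : opens X) (s : A U),
    gdeg (g := A) k s -> gdeg (g := B) k (gmor U s)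
}.

Definition sym_alg (L : omodule O) : graded_oalg :=
  @GradedOAlg (env_sheaf (sym_comm L)) (shf_is_sheaf _)
    (es_scal (sym_comm L)) (es_scal_res (sym_comm L))
    (fun k U => loc_word_span (c := sym_comm L) (pred1 k) (U := U)).

(* A section of the associated graded sheaf is homogeneous of degree k if it is
   locally the class of a section of the k-th step of the filtration. *)
Definition gr_homog (L : omodule O) (c : comm_data L) (k : nat) (U : opens X) :
    set (env_gr_sheaf c U) :=
  fun s => forall x, U x -> exists (V : opens X) (h : V `<=` U)
    (a : env_sheaf c V) (ka : env_filt c V k a),
    V x /\ pres h s = eg_cls ka.

Definition gr_alg (L : lie_algebroid O) : graded_oalg :=
  @GradedOAlg (env_gr_sheaf (lie_comm L)) (shf_is_sheaf _)
    (eg_scal (lie_comm L)) (eg_scal_res (lie_comm L))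
    (@gr_homog L (lie_comm L)).

Section Functoriality.
Variables (M L : omodule O) (phi : omodule_mor M L).
Variables (c : comm_data M) (d : comm_data L).
Hypothesis phi_br : forall (U : opens X) (D E : M U),
  phi U (cbr c D E) = cbr d (phi U D) (phi U E).
Hypothesis phi_act : forall (U : opens X) (D : M U) f,
  cact c D f = cact d (phi U D) f.

Let phiD (U : opens X) D E : phi U (D + E) = phi U D + phi U E.
Proof. by rewrite -[D]scale1r mmap_lin !scale1r. Qed.

Let phiZ (U : opens X) f D : phi U (f *: D) = (idfun f : osec O U) *: phi U D.
Proof.
have phi0 : phi U 0 = 0 by apply: (addIr (phi U 0)); rewrite -phiD !add0r.
by rewrite -[f *: D]addr0 mmap_lin phi0 addr0.
Qed.

Definition env_pre_map_sec (U : opens X) :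
    {rmorphism env_presheaf c U -> env_presheaf d U} :=
  env_map (rho := idfun) (@phiD U) (@phiZ U) (@phi_br U) (@phi_act U).

Lemma env_pre_map_scal (U : opens X) f :
  env_pre_map_sec U (env_scal _ _ f) = env_scal _ _ f.
Proof. exact: env_map_scal. Qed.

Lemma env_pre_map_vec (U : opens X) D :
  env_pre_map_sec U (env_vec _ _ D) = env_vec _ _ (phi U D).
Proof. exact: env_map_vec. Qed.

Lemma env_pre_map_nat (U V : opens X) (h : V `<=` U) (s : env_presheaf c U) :
  env_pre_map_sec V (pres h s) = pres h (env_pre_map_sec U s).
Proof.
apply: (@env_mor_ext _ _ _ _ _
  (env_pre_map_sec V \o (pres h : {rmorphism env_presheaf c U -> _}))
  ((pres h : {rmorphism env_presheaf d U -> _}) \o env_pre_map_sec U))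
  => [f|D].
- apply: etrans (congr1 (env_pre_map_sec V) (env_pres_scal c h f)) _.
  apply: etrans (env_pre_map_scal _) (esym _).
  apply: etrans (congr1 (env_pres d h) (env_pre_map_scal f)) _.
  exact: env_pres_scal.
- apply: etrans (congr1 (env_pre_map_sec V) (env_pres_vec c h D)) _.
  apply: etrans (env_pre_map_vec _) (esym _).
  apply: etrans (congr1 (env_pres d h) (env_pre_map_vec D)) _.
  by apply: etrans (env_pres_vec _ _ _) _; rewrite mmap_res.
Qed.

Definition env_pre_map : rpsh_mor (env_presheaf c) (env_presheaf d) :=
  RPshMor env_pre_map_nat.

Definition env_sheaf_map : rpsh_mor (env_sheaf c) (env_sheaf d) :=
  shf_map env_pre_map.

Lemma env_sheaf_map_scal (U : opens X) f :
  env_sheaf_map U (es_scal c U f) = es_scal d U f.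
Proof.
apply: etrans (shf_map_unit _ _) _.
by congr (shf_unit _ _ _); exact: env_pre_map_scal.
Qed.

Lemma env_sheaf_map_vec (U : opens X) D :
  env_sheaf_map U (es_vec c D) = es_vec d (phi U D).
Proof.
apply: etrans (shf_map_unit _ _) _.
by congr (shf_unit _ _ _); exact: env_pre_map_vec.
Qed.

Lemma env_sheaf_map_word (U : opens X) (p : osec O U * seq (M U)) :
  env_sheaf_map U (word c p) = word d (p.1, map (phi U) p.2).
Proof.
rewrite /word rmorphM rmorph_prod env_sheaf_map_scal big_map /=.
by congr (_ * _); apply: eq_bigr => D _; exact: env_sheaf_map_vec.
Qed.

Lemma env_sheaf_map_span P (U : opens X) (s : env_sheaf c U) :
  loc_word_span P s -> loc_word_span P (env_sheaf_map U s).
Proof.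
move=> h x /h [V [k [Vx [ps [hps e]]]]]; exists V, k; split=> //.
exists [seq (p.1, map (phi V) p.2) | p <- ps]; split.
  by rewrite all_map; apply: sub_all hps => p /=; rewrite size_map.
rewrite -rmapE e rmorph_sum big_map; apply: eq_bigr => p _.
exact: env_sheaf_map_word.
Qed.

Lemma env_sheaf_map_filt (U : opens X) k (s : env_sheaf c U) :
  env_filt c U k s -> env_filt d U k (env_sheaf_map U s).
Proof. exact: env_sheaf_map_span. Qed.

Definition env_gr_pre_map_sec (U : opens X) :
    {rmorphism env_gr_presheaf c U -> env_gr_presheaf d U} :=
  gr_map (@env_sheaf_map_filt U).

Lemma env_gr_pre_map_nat (U V : opens X) (h : V `<=` U)
  (s : env_gr_presheaf c U) :
  env_gr_pre_map_sec V (pres h s) = pres h (env_gr_pre_map_sec U s).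
Proof.
apply: (gr_mor_ext
  (u := env_gr_pre_map_sec V \o (pres h : {rmorphism env_gr_presheaf c U -> _}))
  (v := (pres h : {rmorphism env_gr_presheaf d U -> _}) \o
        env_gr_pre_map_sec U)) => k a ka.
apply: etrans (congr1 (env_gr_pre_map_sec V) (gr_map_cls _ _)) _.
apply: etrans (gr_map_cls _ _) (esym _).
apply: etrans (congr1 (env_gr_res d h) (gr_map_cls _ _)) _.
apply: etrans (gr_map_cls _ _) _.
by apply: gr_cls_irr; apply/esym; exact: rmapE.
Qed.

Definition env_gr_pre_map : rpsh_mor (env_gr_presheaf c) (env_gr_presheaf d) :=
  RPshMor env_gr_pre_map_nat.

Definition env_gr_sheaf_map : rpsh_mor (env_gr_sheaf c) (env_gr_sheaf d) :=
  shf_map env_gr_pre_map.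

Lemma env_gr_sheaf_map_cls (U : opens X) k (a : env_sheaf c U)
    (ka : env_filt c U k a) :
  env_gr_sheaf_map U (eg_cls ka) = eg_cls (env_sheaf_map_filt ka).
Proof.
apply: etrans (shf_map_unit _ _) _.
by congr (shf_unit _ _ _); exact: gr_map_cls.
Qed.

Lemma env_gr_sheaf_map_scal (U : opens X) f :
  env_gr_sheaf_map U (eg_scal c U f) = eg_scal d U f.
Proof.
apply: etrans (env_gr_sheaf_map_cls _) _.
congr (shf_unit _ _ _); apply: gr_cls_irr; exact: env_sheaf_map_scal.
Qed.

Lemma env_gr_sheaf_map_homog k (U : opens X) (s : env_gr_sheaf c U) :
  gr_homog k s -> gr_homog k (env_gr_sheaf_map U s).
Proof.
move=> h x /h [V [l [a [ka [Vx e]]]]].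
exists V, l, (env_sheaf_map V a), (env_sheaf_map_filt ka); split=> //.
by rewrite -rmapE e env_gr_sheaf_map_cls.
Qed.

End Functoriality.

Section Induced.
Variables (M L : lie_algebroid O) (phi : lie_morphism M L).

Let sym_br (U : opens X) (D E : M U) :
  phi U (cbr (sym_comm M) D E) = cbr (sym_comm L) (phi U D) (phi U E).
Proof.
rewrite /=; apply: (addIr (phi U 0)).
by rewrite -[X in X + _]scale1r -mmap_lin scale1r !add0r.
Qed.

Let sym_act (U : opens X) (D : M U) f :
  cact (sym_comm M) D f = cact (sym_comm L) (phi U D) f.
Proof. by []. Qed.

Definition sym_map : graded_mor (sym_alg M) (sym_alg L) :=
  @GradedMor (sym_alg M) (sym_alg L) (env_sheaf_map sym_br sym_act)
    (env_sheaf_map_scal sym_br sym_act)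
    (fun k => @env_sheaf_map_span _ _ _ _ _ sym_br sym_act (pred1 k)).

Let lie_act (U : opens X) (D : M U) f :
  cact (lie_comm M) D f = cact (lie_comm L) (phi U D) f.
Proof. by rewrite /= lmap_anchor. Qed.

Definition uenv_map : rpsh_mor (env_sheaf (lie_comm M)) (env_sheaf (lie_comm L)) :=
  env_sheaf_map (c := lie_comm M) (d := lie_comm L) (lmap_br phi) lie_act.

Definition gr_uenv_map : graded_mor (gr_alg M) (gr_alg L) :=
  @GradedMor (gr_alg M) (gr_alg L)
    (env_gr_sheaf_map (c := lie_comm M) (d := lie_comm L) (lmap_br phi) lie_act)
    (env_gr_sheaf_map_scal (c := lie_comm M) (d := lie_comm L)
       (lmap_br phi) lie_act)
    (env_gr_sheaf_map_homog (c := lie_comm M) (d := lie_comm L)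
       (lmap_br phi) lie_act).

End Induced.

Section Symmetrization.
Variable L : lie_algebroid O.

(* 1/k! times the sum over s in S_k of D_(s 1) ... D_(s k). *)
Definition env_symm (U : opens X) (k : nat) (D : 'I_k -> L U) :
    env_sheaf (lie_comm L) U :=
  es_scal (lie_comm L) U (ocst U (k`!%:R^-1)) *
  \sum_(s : 'S_k) \prod_(i < k) es_vec (lie_comm L) (D (s i)).

Lemma env_symm_filt (U : opens X) (k : nat) (D : 'I_k -> L U) :
  env_filt (lie_comm L) U k (env_symm D).
Proof.
apply: (@flM _ (env_filt (lie_comm L) U) 0); first exact: env_filt_scal.
apply: (big_ind (env_filt (lie_comm L) U k)); [exact: fl0|exact: flD|].
by move=> s _; exact: (env_filt_prod (lie_comm L) (fun i => D (s i))).
Qed.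

Definition is_symmetrization (psi : graded_mor (sym_alg L) (gr_alg L)) : Prop :=
  forall (U : opens X) (k : nat) (D : 'I_k -> L U),
    psi U (\prod_(i < k) es_vec (sym_comm L) (D i)) = eg_cls (env_symm_filt D).

Definition is_pbw_iso (psi : graded_mor (gr_alg L) (sym_alg L)) : Prop :=
  exists2 sym : graded_mor (sym_alg L) (gr_alg L), is_symmetrization sym &
    forall U : opens X, cancel (sym U) (psi U) /\ cancel (psi U) (sym U).

End Symmetrization.
End GradedAlgebras.

Lemma sym_mulC (R : comPzRingType) (L : lmodType R)
    (a b : env (fun _ _ : L => 0) (fun (_ : L) (_ : R) => 0)) :
  a * b = b * a.
Proof.
have sub0 (x y : env (fun _ _ : L => 0) (fun (_ : L) (_ : R) => 0)) :
  x - y = 0 -> x = y by move=> /eqP; rewrite subr_eq0 => /eqP.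
have env_vec0 :
    env_vec (fun _ _ : L => 0) (fun (_ : L) (_ : R) => 0) 0 = 0.
  by rewrite -(scale0r 0) env_vecZE rmorph0 mul0r.
elim/env_ind: a b => [f|D|a ha|a a' ha ha'|a a' ha ha'] b.
- elim/env_ind: b => [g|D|b hb|b b' hb hb'|b b' hb hb'].
  + by rewrite -!rmorphM mulrC.
  + by apply/esym/sub0; rewrite env_scal_commE rmorph0.
  + by rewrite mulrN mulNr hb.
  + by rewrite mulrDr mulrDl hb hb'.
  + by rewrite mulrA hb -mulrA hb' mulrA.
- elim/env_ind: b => [g|E|b hb|b b' hb hb'|b b' hb hb'].
  + by apply/sub0; rewrite env_scal_commE rmorph0.
  + by apply/sub0; rewrite env_vec_commE.
  + by rewrite mulrN mulNr hb.
  + by rewrite mulrDr mulrDl hb hb'.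
  + by rewrite mulrA hb -mulrA hb' mulrA.
- by rewrite mulrN mulNr ha.
- by rewrite mulrDr mulrDl ha ha'.
- by rewrite -mulrA ha' mulrA ha -mulrA.
Qed.

Lemma prod_perm (A : pzRingType) (mulC : commutative (@GRing.mul A)) k
    (D : 'I_k -> A) (s : 'S_k) :
  \prod_(i < k) D i = \prod_(i < k) D (s i).
Proof.
pose AC := HB.pack_for comPzRingType A
  (GRing.PzRing_hasCommutativeMul.Build A mulC).
exact: (@reindex_inj AC *%R 1 _ s predT D (@perm_inj _ s)).
Qed.

Section SymmetrizationExists.
Variables (K : fieldType) (Kop : set (set K)) (X : topologicalType).
Variables (O : ringed_space Kop X) (L : lie_algebroid O).
Local Notation S := (sym_comm L).
Local Notation C := (lie_comm L).

Let g (U : opens X) (D : L U) : env_gr C U := gr_cls (env_filt_vec C D).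

Lemma sym_pre_compat (U : opens X) :
  env_compat (@cbr _ _ _ _ _ S U) (@cact _ _ _ _ _ S U) (eg_scal_pre C U)
    (@g U).
Proof.
have g0 : g (0 : L U) = 0.
  rewrite -(gr_cls0 (fl0 (env_filt C U) 1)); apply: gr_cls_irr.
  by rewrite -(scale0r 0) es_vecZ rmorph0 mul0r.
split=> [D E|f D|D E|D f].
- have h : env_filt C U 1 (es_vec C D + es_vec C E).
    by apply: flD; exact: env_filt_vec.
  by rewrite (gr_clsD _ _ h); apply: gr_cls_irr; exact: es_vecD.
- have h : env_filt C U (0 + 1)%N (es_scal C U f * es_vec C D).
    by apply: flM; [exact: env_filt_scal|exact: env_filt_vec].
  by rewrite eg_scal_preE (gr_clsM _ _ h); apply: gr_cls_irr; exact: es_vecZ.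
- have h D' E' : env_filt C U (1 + 1)%N (es_vec C D' * es_vec C E').
    by apply: flM; exact: env_filt_vec.
  rewrite [RHS]g0 /g (gr_clsM _ _ (h D E)) (gr_clsM _ _ (h E D)).
  rewrite (gr_clsN _ (flN (h E D))) (gr_clsD _ _ (flB (h D E) (h E D))).
  rewrite -(gr_cls0 (fl0 (env_filt C U) (1 + 1))); apply: gr_cls_eq.
  by rewrite subr0 es_vec_comm; exact: env_filt_vec.
- have h : env_filt C U (0 + 1)%N (es_scal C U f * es_vec C D).
    by apply: flM; [exact: env_filt_scal|exact: env_filt_vec].
  have h' : env_filt C U (0 + 1)%N (es_vec C D * es_scal C U f).
    by apply: (@flM _ (env_filt C U) 1 0); [exact: env_filt_vec|exact: env_filt_scal].
  have e : gr_cls (env_filt_vec C D) * gr_cls (env_filt_scal C f) = gr_cls h'.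
    exact: gr_clsM.
  rewrite [RHS]rmorph0 /g eg_scal_preE (gr_clsM _ _ h) e.
  rewrite (gr_clsN _ (flN h)) (gr_clsD _ _ (flB h' h)).
  rewrite -(gr_cls0 (fl0 (env_filt C U) (0 + 1))); apply: gr_cls_eq.
  by rewrite subr0 es_scal_comm; exact: env_filt_scal.
Qed.

Let sec (U : opens X) : {rmorphism env_presheaf S U -> env_gr_presheaf C U} :=
  env_lift (sym_pre_compat U).

Let sec_scal (U : opens X) f :
  sec U (env_scal _ _ f) = gr_cls (env_filt_scal C f).
Proof. exact: (env_lift_scal (sym_pre_compat U)). Qed.

Let sec_vec (U : opens X) (D : L U) : sec U (env_vec _ _ D) = g D.
Proof. exact: (env_lift_vec (sym_pre_compat U)). Qed.

Let sec_nat (U V : opens X) (h : V `<=` U) (s : env_presheaf S U) :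
  sec V (pres h s) = pres h (sec U s).
Proof.
apply: (@env_mor_ext _ _ _ _ _
  (sec V \o (pres h : {rmorphism env_presheaf S U -> _}))
  ((pres h : {rmorphism env_gr_presheaf C U -> _}) \o sec U)) => [f|D].
- apply: etrans (congr1 (sec V) (env_pres_scal S h f)) _.
  apply: etrans (sec_scal _) (esym _).
  apply: etrans (congr1 (env_gr_res C h) (sec_scal f)) _.
  apply: etrans (gr_map_cls _ _) _.
  by apply: gr_cls_irr; exact: es_scal_res.
- apply: etrans (congr1 (sec V) (env_pres_vec S h D)) _.
  apply: etrans (sec_vec _) (esym _).
  apply: etrans (congr1 (env_gr_res C h) (sec_vec D)) _.
  apply: etrans (gr_map_cls _ _) _.
  by apply: gr_cls_irr; exact: es_vec_res.
Qed.

Let symz : rpsh_mor (env_sheaf S) (env_gr_sheaf C) := shf_map (RPshMor sec_nat).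

Let symz_scal (U : opens X) f : symz U (es_scal S U f) = eg_scal C U f.
Proof.
apply: etrans (shf_map_unit _ _) _.
by congr (shf_unit _ _ _); exact: sec_scal.
Qed.

Let symz_vec (U : opens X) (D : L U) :
  symz U (es_vec S D) = eg_cls (env_filt_vec C D).
Proof.
apply: etrans (shf_map_unit _ _) _.
by congr (shf_unit _ _ _); exact: sec_vec.
Qed.

Let eg_clsM (U : opens X) i j a b (ia : env_filt C U i a) (jb : env_filt C U j b)
  (ijab : env_filt C U (i + j)%N (a * b)) :
  eg_cls ia * eg_cls jb = eg_cls ijab.
Proof. by rewrite /eg_cls -rmorphM (gr_clsM _ _ ijab). Qed.

Let eg_cls_irr (U : opens X) i j a b (ia : env_filt C U i a)
    (jb : env_filt C U j b) : i = j -> a = b -> eg_cls ia = eg_cls jb.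
Proof.
move=> ij ab; subst j; congr (shf_unit _ _ _); exact: gr_cls_irr.
Qed.

Let symz_prod (U : opens X) (w : seq (L U))
  (h : env_filt C U (size w) (\prod_(D <- w) es_vec C D)) :
  symz U (\prod_(D <- w) es_vec S D) = eg_cls h.
Proof.
elim: w h => [|D w ih] h.
  rewrite big_nil rmorph1 -(rmorph1 (shf_unit (env_gr_presheaf C) U)).
  congr (shf_unit _ _ _); rewrite -(gr_cls1 (fl1 (env_filt C U))).
  by apply: gr_cls_irr; rewrite big_nil.
rewrite big_cons rmorphM symz_vec.
have hw : env_filt C U (size w) (\prod_(D <- w) es_vec C D).
  apply: loc_word_span_of; have := @word_span_word _ _ _ _ _ C U
    (leq^~ (size w)) (1, w).
  by rewrite /word rmorph1 mul1r; apply.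
have k : env_filt C U (1 + size w)%N (es_vec C D * \prod_(D <- w) es_vec C D).
  by apply: flM => //; exact: env_filt_vec.
by rewrite (ih hw) (eg_clsM _ _ k); apply: eg_cls_irr; rewrite ?big_cons.
Qed.

Let symz_prod_ord (U : opens X) k (D : 'I_k -> L U)
  (h : env_filt C U k (\prod_(i < k) es_vec C (D i))) :
  symz U (\prod_(i < k) es_vec S (D i)) = eg_cls h.
Proof.
have e c : \prod_(i < k) es_vec c (D i) =
  \prod_(E <- [seq D i | i <- index_enum 'I_k]) es_vec c E by rewrite big_map.
have sz : size [seq D i | i <- index_enum 'I_k] = k.
  by rewrite size_map -[RHS]size_enum_ord enumT /index_enum unlock.
have h' := h; rewrite e -[X in env_filt C U X _]sz in h'.
rewrite e (symz_prod h'); apply: eg_cls_irr; first exact: sz.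
exact/esym/e.
Qed.

Let symz_deg k (U : opens X) (s : env_sheaf S U) :
  loc_word_span (c := S) (pred1 k) s -> gr_homog k (symz U s).
Proof.
move=> hs x /hs [V [h [Vx [ps [hps e]]]]]; exists V, h.
rewrite -rmapE e {e hs}; elim: ps hps => [|p ps ih].
  move=> _; exists 0, (fl0 (env_filt C V) k); split=> //.
  rewrite big_nil rmorph0 -(rmorph0 (shf_unit (env_gr_presheaf C) V)).
  by congr (shf_unit _ _ _); rewrite gr_cls0.
case/andP=> /eqP sp /ih [a [ka [_ ea]]].
have hw : env_filt C V (size p.2) (\prod_(D <- p.2) es_vec C D).
  apply: loc_word_span_of; have := @word_span_word _ _ _ _ _ C V
    (leq^~ (size p.2)) (1, p.2).
  by rewrite /word rmorph1 mul1r; apply.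
have kw : env_filt C V (0 + size p.2)%N
    (es_scal C V p.1 * \prod_(D <- p.2) es_vec C D).
  by apply: flM => //; exact: env_filt_scal.
have kw' : env_filt C V k (word C p) by move: kw; rewrite add0n sp.
exists (word C p + a), (@flD _ (env_filt C V) _ _ _ kw' ka); split=> //.
rewrite big_cons rmorphD ea /word rmorphM symz_scal (symz_prod hw).
have -> : eg_scal C V p.1 = eg_cls (env_filt_scal C p.1) by [].
rewrite (eg_clsM _ _ kw) /eg_cls -(gr_clsD kw' ka (flD kw' ka)) rmorphD; congr (_ + _).
exact: (@eg_cls_irr V _ _ _ _ kw kw').
Qed.

(* The symmetrization map is well defined, as K has characteristic 0. *)
Lemma symmetrization_exists : [pchar K] =i pred0 ->
  exists psi : graded_mor (sym_alg L) (gr_alg L), is_symmetrization psi.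
Proof.
move=> K0; exists (@GradedMor _ _ _ _ (sym_alg L) (gr_alg L) symz symz_scal
  symz_deg) => U k D /=.
pose P := \prod_(i < k) es_vec S (D i).
have hp (s : 'S_k) := env_filt_prod C (fun i => D (s i)).
have symP (s : 'S_k) : symz U P = eg_cls (hp s).
  rewrite -symz_prod_ord; congr (symz U _).
  rewrite /P /es_vec -!rmorph_prod; congr (shf_unit _ _ _).
  exact: (@prod_perm _ (@sym_mulC _ (L U)) _ _ s).
have hsum : env_filt C U k
    (\sum_(s : 'S_k) \prod_(i < k) es_vec C (D (s i))).
  by apply: (big_ind (env_filt C U k)) => //; [exact: fl0|move=> *; exact: flD].
have sumP : eg_cls hsum = (k`!)%:R * symz U P.
  have gen (r : seq 'S_k)
      (h : env_filt C U k (\sum_(s <- r) \prod_(i < k) es_vec C (D (s i)))) :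
      eg_cls h = (size r)%:R * symz U P.
    elim: r h => [|s r ih] h.
      rewrite mul0r -(rmorph0 (shf_unit (env_gr_presheaf C) U)).
      congr (shf_unit _ _ _); rewrite -(gr_cls0 (fl0 (env_filt C U) k)).
      by apply: gr_cls_irr; rewrite big_nil.
    have hr : env_filt C U k (\sum_(s <- r) \prod_(i < k) es_vec C (D (s i))).
      by apply: (big_ind (env_filt C U k)) => //; [exact: fl0|move=> *; exact: flD].
    rewrite -[size _]/(size r).+1 -natr1 mulrDl mul1r -(ih hr) (symP s) addrC.
    rewrite /eg_cls -rmorphD (gr_clsD _ _ (flD (hp s) hr)).
    by congr (shf_unit _ _ _); apply: gr_cls_irr; rewrite big_cons.
  rewrite (gen _ hsum); congr (_%:R * _).
  by rewrite -card_Sn -sum1_size -sum1_card; apply: eq_bigl => s; rewrite inE.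
have k0 : env_filt C U (0 + k)%N (env_symm D) by exact: env_symm_filt.
transitivity (eg_cls k0); last exact: eg_cls_irr.
rewrite -(eg_clsM (env_filt_scal C (ocst U k`!%:R^-1)) hsum) sumP mulrA.
have -> : eg_cls (env_filt_scal C (ocst U k`!%:R^-1)) =
  eg_scal C U (ocst U k`!%:R^-1) by [].
rewrite -(rmorph_nat (eg_scal C U)) -rmorphM.
suff -> : ocst U k`!%:R^-1 * (k`!)%:R = 1 :> osec O U by rewrite rmorph1 mul1r.
have -> : (k`!)%:R = ocst U (k`!)%:R :> osec O U.
  elim: (k`!) => [|n ih]; first exact: val_inj.
  by rewrite -!natr1 ih; exact: val_inj.
apply: val_inj; apply/funext => x; rewrite /= /GRing.mul /= mulVf //.
by rewrite (iffLR (pcharf0P _) K0) -lt0n fact_gt0.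
Qed.

End SymmetrizationExists.

(* Main.v *)
(** The maps [sym' : Sym L' -> gr U(L')] and [sym : Sym L -> gr U(L)] inverse to
    [psi'] and [psi] are morphisms of sheaves of algebras which, by the degree
    one case of the symmetrization formula, send a section [D] to its class in
    degree 1.  So [gr (U phi) \o sym'] and [sym \o Sym phi] agree on O and on L',
    hence everywhere: the symmetrization map is natural, and so is its inverse. *)

Require Import Defs.
From mathcomp Require Import all_boot all_order all_algebra.
From mathcomp Require Import all_classical all_reals topology normedtype.
From mathcomp Require Import perm.

Set Implicit Arguments.
Unset Strict Implicit.
Unset Printing Implicit Defensive.

Import GRing.Theory.
Local Open Scope classical_set_scope.
Local Open Scope ring_scope.

Section Composition.
Variables (X : topologicalType) (F G H : rpresheaf X).
Variables (v : rpsh_mor G H) (u : rpsh_mor F G).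

Lemma rpsh_comp_nat (U V : opens X) (h : V `<=` U) (s : F U) :
  (v V \o u V) (pres h s) = pres h ((v U \o u U) s).
Proof. by rewrite /= !rmapE. Qed.

(** Bundled so that the two sides of the naturality square can be compared by extensionality. *)
Definition rpsh_comp : rpsh_mor F H :=
  @RPshMor X F H (fun U => v U \o u U : {rmorphism F U -> H U}) rpsh_comp_nat.

End Composition.

(** A section of [shf F] comes locally from [F], and equality in the sheaf [G] can be checked
    locally. *)
Lemma shf_mor_ext (X : topologicalType) (F G : rpresheaf X)
    (G_sheaf : is_sheaf G) (u v : rpsh_mor (shf F) G) :
  (forall (U : opens X) (s : F U),
     u U (shf_unit F U s) = v U (shf_unit F U s)) ->
  forall U : opens X, u U =1 v U.
Proof.
move=> uv U s; apply: (proj1 G_sheaf) => x Ux.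
have [V [h [t [Vx e]]]] := shf_locally_unit s Ux.
by exists V, h; split=> //; rewrite -!rmapE e uv.
Qed.

Section Naturality.
Variables (K : fieldType) (Kop : set (set K)) (X : topologicalType).
Variable O : ringed_space Kop X.

(** Over each open set the presheaf of algebras is generated by functions and by sections of [L];
    sheafification then adds only local gluings. *)
Lemma env_sheaf_mor_ext (L : omodule O) (c : comm_data L) (G : rpresheaf X)
    (G_sheaf : is_sheaf G) (u v : rpsh_mor (env_sheaf c) G) :
  (forall (U : opens X) f, u U (es_scal c U f) = v U (es_scal c U f)) ->
  (forall (U : opens X) (D : L U), u U (es_vec c D) = v U (es_vec c D)) ->
  forall U : opens X, u U =1 v U.
Proof.
move=> us uv; apply: shf_mor_ext => // U.
apply: (@env_mor_ext _ _ _ _ _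
  (u U \o (shf_unit (env_presheaf c) U : {rmorphism env_presheaf c U -> _}))
  (v U \o (shf_unit (env_presheaf c) U : {rmorphism env_presheaf c U -> _}))).
- exact: us.
- exact: uv.
Qed.

Lemma eg_cls_irr (L : omodule O) (c : comm_data L) (U : opens X) k
    (a b : env_sheaf c U) (ka : env_filt c U k a) (kb : env_filt c U k b) :
  a = b -> eg_cls ka = eg_cls kb.
Proof. by move=> ab; congr (shf_unit _ _ _); exact: gr_cls_irr. Qed.

Lemma env_symm1 (L : lie_algebroid O) (U : opens X) (D : L U) :
  env_symm (fun _ : 'I_1 => D) = es_vec (lie_comm L) D.
Proof.
(* The family is constant, so each product is its single factor, whatever the permutation. *)
rewrite /env_symm (eq_bigr (fun=> es_vec (lie_comm L) D)); last first.
  by move=> s _; rewrite big_ord1.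
rewrite sumr_const (eq_card (B := 'S_1)) // card_Sn invr1.
have -> : ocst U 1 = 1 :> osec O U by exact: val_inj.
by rewrite rmorph1 mul1r.
Qed.

Lemma symmetrization_vec (L : lie_algebroid O)
    (sym : graded_mor (sym_alg L) (gr_alg L)) (symP : is_symmetrization sym)
    (U : opens X) (D : L U) :
  sym U (es_vec (sym_comm L) D) = eg_cls (env_filt_vec (lie_comm L) D).
Proof.
have := symP U 1%N (fun=> D); rewrite big_ord1 => ->.
exact/eg_cls_irr/env_symm1.
Qed.

Lemma sym_map_vec (M L : lie_algebroid O) (phi : lie_morphism M L)
    (U : opens X) (D : M U) :
  sym_map phi U (es_vec (sym_comm M) D) = es_vec (sym_comm L) (phi U D).
Proof. exact: env_sheaf_map_vec. Qed.

Lemma gr_uenv_map_vec (M L : lie_algebroid O) (phi : lie_morphism M L)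
    (U : opens X) (D : M U) :
  gr_uenv_map phi U (eg_cls (env_filt_vec (lie_comm M) D)) =
  eg_cls (env_filt_vec (lie_comm L) (phi U D)).
Proof.
apply: etrans (env_gr_sheaf_map_cls _ _ _) _.
exact/eg_cls_irr/env_sheaf_map_vec.
Qed.

(** Both composites fix functions, and both send a section [D] of [M] to the degree 1 class of
    [phi U D]; such sections and functions generate [sym_alg M] locally. *)
Lemma symmetrization_natural (M L : lie_algebroid O) (phi : lie_morphism M L)
    (symM : graded_mor (sym_alg M) (gr_alg M))
    (symL : graded_mor (sym_alg L) (gr_alg L)) :
  is_symmetrization symM -> is_symmetrization symL ->
  forall (U : opens X) (t : sym_alg M U),
    gr_uenv_map phi U (symM U t) = symL U (sym_map phi U t).
Proof.
move=> symMP symLP.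
apply: (env_sheaf_mor_ext (c := sym_comm M) (galg_sheaf (gr_alg L))
  (u := rpsh_comp (gr_uenv_map phi) symM)
  (v := rpsh_comp symL (sym_map phi))) => [U f|U D].
- apply: etrans (congr1 (gr_uenv_map phi U) (gmor_unit symM f)) _.
  apply: etrans (gmor_unit (gr_uenv_map phi) f) (esym _).
  apply: etrans (congr1 (symL U) (gmor_unit (sym_map phi) f)) _.
  exact: gmor_unit.
- rewrite -[LHS]/(gr_uenv_map phi U (symM U _)) (symmetrization_vec symMP).
  by rewrite gr_uenv_map_vec -(symmetrization_vec symLP) -sym_map_vec.
Qed.

End Naturality.

Theorem theorem7p6
  (K : fieldType) (Kop : set (set K)) (K_base : base_field Kop)
  (X : topologicalType) (O : ringed_space Kop X)
  (L : lie_algebroid O) (L_free : locally_free L)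
  (L' : lie_algebroid O) (phi : lie_morphism L' L) (L'_free : locally_free L')
  (psi' : graded_mor (gr_alg L') (sym_alg L')) (psi'_pbw : is_pbw_iso psi')
  (psi : graded_mor (gr_alg L) (sym_alg L)) (psi_pbw : is_pbw_iso psi) :
  forall (U : opens X) (s : gr_alg L' U),
    sym_map phi U (psi' U s) = psi U (gr_uenv_map phi U s).
Proof.
move=> U s; have [sym' sym'P /(_ U) [_ psi'K]] := psi'_pbw.
have [sym symP /(_ U) [symK _]] := psi_pbw.
(* Only the [s] on the right becomes [sym' U (psi' U s)]; naturality then brings [sym U] next to
   [psi U], where they cancel. *)
by rewrite -{2}(psi'K s) (symmetrization_natural phi sym'P symP) symK.
Qed.
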